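(* There exists $\alpha_0>2$ such that the following holds for every $\alpha\ge\alpha_0$. Let $\nu$ be a probability measure on $\mathbb R_+$ with $\nu([r,\infty))\le c_\nu r^{-\alpha}$ for all $r\ge0$, for some constant $c_\nu>0$, and let $f$ be the coloring given by the Confetti random environment with radius distribution $\nu$. Then there exist $c_2,\xi>0$ such that, if $\delta\le c_2$, the random walk $(X_n)_{n\in\mathbb N}$ on the environment $f$ with parameter $\delta\in[0,1/2]$ satisfies $$\inf_{n\ge1}\mathbb P\big(|X_n|\ge n^\xi\big)>0.$$
   Context: Confetti random environment: consider a Poisson point process $\omega=\sum_{i\ge0}\delta_{(u_i,r_i,d_i,w_i)}$ on $\mathbb R^2\times\mathbb R_+\times\{-1,1\}\times[0,1]$ with intensity $\lambda(du)\otimes\nu(dr)\otimes\frac12(\delta_{-1}+\delta_1)\otimes\lambda(dw)$, $\lambda$ being Lebesgue measure. The point $(u_i,r_i,d_i,w_i)$ represents a ball with center $u_i$, radius $r_i$, color $d_i$ and weight $w_i$. Ball $i$ covers $z\in\mathbb R^2$ if the distance from $z$ to $u_i$ is at most $r_i$. Let $I_z$ be the index $i$ maximizing $w_i$ among balls covering $z$, with $I_z=\infty$ if no ball covers $z$. Then $f(z)=d_{I_z}$ if $I_z<\infty$ and $f(z)=0$ otherwise. The environment on $\mathbb Z^2$ is the restriction of $f$ to $\mathbb Z^2$. The random walk: given a realization of $f$ and $\delta\in[0,1/2]$, $X_0=0$ and $(X_n)_{n\ge0}$ is the Markov process on $\mathbb Z$ with $\mathbb P^f(X_{n+1}=x+1\mid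 X_n=x)=1-\mathbb P^f(X_{n+1}=x-1\mid X_n=x)=\frac12+\delta\big(\mathbf 1_{\{f(x,n)>0\}}-\mathbf 1_{\{f(x,n)<0\}}\big)$. $\mathbb P$ is the annealed law (averaged over $f$). *)

(* Defs.v *)
From HB Require Import structures.
From mathcomp Require Import all_boot all_order all_algebra.
From mathcomp Require Import all_classical all_reals all_analysis.

Set Implicit Arguments.
Unset Strict Implicit.
Unset Printing Implicit Defensive.
Import Order.TTheory GRing.Theory Num.Theory.
Import numFieldNormedType.Exports.

Local Open Scope classical_set_scope.
Local Open Scope ring_scope.

Section PoissonPointProcess.
Context (R : realType) (d d' : measure_display).
Context (Omega : measurableType d) (T : measurableType d').
Implicit Types (P : probability Omega R) (mu : {measure set T -> \bar R}).

(* The library's [poisson_pmf] is constantly 1 at rate 0; null sets must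
   instead receive the point mass at 0, hence a definition of our own. *)
Definition poisson_mass (rate : R) (n : nat) : R :=
  rate ^+ n / n`!%:R * expR (- rate).

(* The random measure \sum_i \delta_(pt i) evaluated at A. *)
Definition point_measure (pt : nat -> Omega -> T) (omega : Omega) (A : set T)
  : \bar R := (\sum_(0 <= i <oo) \d_(pt i omega) A)%E.

(* Independence of the counts over disjoint sets and their Poisson marginals
   are expressed together by the joint law of the counts.  Enumerating the
   points by nat loses no generality when mu has infinite total mass. *)
Record poisson_point_process P mu (pt : nat -> Omega -> T) : Prop := {
  ppp_measurable : forall i, measurable_fun setT (pt i) ;
  ppp_counts : forall (k : nat) (A : 'I_k -> set T) (n : 'I_k -> nat),
    (forall j, measurable (A j)) ->
    (forall j, (mu (A j) < +oo)%E) ->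
    trivIset setT A ->
    P [set omega | forall j, point_measure pt omega (A j) = (n j)%:R%:E] =
    (\prod_(j < k) poisson_mass (fine (mu (A j))) (n j))%:E }.

End PoissonPointProcess.

Section Confetti.
Context (R : realType).
Local Notation mR := (measurableTypeR R).

(* (u, r, d, w) with u in R^2: center, radius, color, weight. *)
Definition ball_type := (mR * mR * mR * mR * mR)%type.

Definition center (b : ball_type) : R * R := b.1.1.1.
Definition radius (b : ball_type) : R := b.1.1.2.
Definition color (b : ball_type) : R := b.1.2.
Definition weight (b : ball_type) : R := b.2.

(* R^2 x R_+ x {-1,1} x [0,1] *)
Definition ball_space : set ball_type :=
  [set b | [/\ 0 <= radius b, color b = -1 \/ color b = 1
             & 0 <= weight b <= 1]].

Definition color_measure : set mR -> \bar R :=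
  mscale (2^-1)%:nng (measure_add \d_(-1 : mR) \d_(1 : mR)).

HB.instance Definition _ := Measure.on color_measure.

Let color_measureT : color_measure setT = 1%E.
Proof.
rewrite /color_measure /mscale /= /msum 2!big_ord_recl big_ord0 /= adde0 !diracT.
by rewrite -EFinD -EFinM mulVf// pnatr_eq0.
Qed.

HB.instance Definition _ :=
  Measure_isProbability.Build _ _ _ color_measure color_measureT.

Definition confetti_intensity (nu : probability mR R) :
    {measure set ball_type -> \bar R} :=
  ((lebesgue_measure \x lebesgue_measure) \x nu \x color_measure
     \x uniform_prob (@ltr01 R))%E.

(* The Euclidean distance; the library's norm on R * R is the sup norm. *)
Definition dist2 (z u : R * R) : R :=
  Num.sqrt ((z.1 - u.1) ^+ 2 + (z.2 - u.2) ^+ 2).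

Definition covers (b : ball_type) (z : R * R) : Prop :=
  dist2 z (center b) <= radius b.

Definition is_top (b : nat -> ball_type) (z : R * R) (i : nat) : Prop :=
  covers (b i) z /\
  forall j, j <> i -> covers (b j) z -> weight (b j) < weight (b i).

(* I_z, with None for infinity.  None is also returned when the maximal weight
   is tied or not attained. *)
Definition top_index (b : nat -> ball_type) (z : R * R) : option nat :=
  if `[< exists i, is_top b z i >] then Some (xget 0%N (is_top b z)) else None.

Definition confetti (b : nat -> ball_type) (z : R * R) : R :=
  if top_index b z is Some i then color (b i) else 0.

Definition confetti_env (b : nat -> ball_type) (z : int * int) : R :=
  confetti b (z.1%:~R, z.2%:~R).

End Confetti.

Section RandomWalk.
Context (R : realType).

Definition up_prob (delta : R) (f : int * int -> R) (x : int) (n : nat) : R :=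
  2^-1 + delta * ((0 < f (x, n%:Z))%R%:R - (f (x, n%:Z) < 0)%R%:R).

Definition step_prob (delta : R) (f : int * int -> R) (n : nat) (x y : int) : R :=
  if y == x + 1 then up_prob delta f x n
  else if y == x - 1 then 1 - up_prob delta f x n
  else 0.

(* P^f (X_0 = x 0, ..., X_n = x n) for the Markov chain started at 0. *)
Definition quenched_path_prob (delta : R) (f : int * int -> R) (n : nat)
    (x : nat -> int) : R :=
  (x 0%N == 0)%:R * \prod_(k < n) step_prob delta f k (x k) (x k.+1).

Context (d : measure_display) (Omega : measurableType d).

Definition env_sigma_algebra (f : Omega -> int * int -> R) : set (set Omega) :=
  <<s [set A | exists (z : int * int) (B : set (measurableTypeR R)),
         measurable B /\ A = (fun omega => f omega z) @^-1` B] >>.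

(* Conditionally on the environment f, the process X has law P^f; thus P is the
   annealed law of X. *)
Record random_walk_in (P : probability Omega R) (delta : R)
    (f : Omega -> int * int -> R) (X : nat -> Omega -> int) : Prop := {
  rw_measurable : forall n x, measurable (X n @^-1` [set x]) ;
  rw_law : forall (A : set Omega) (n : nat) (x : nat -> int),
    env_sigma_algebra f A ->
    P (A `&` [set omega | forall k, (k <= n)%N -> X k omega = x k]) =
    (\int[P]_(omega in A) (quenched_path_prob delta (f omega) n x)%:E)%E }.

End RandomWalk.

(* Main.v *)
Require Import Defs.
From HB Require Import structures.
From mathcomp Require Import all_boot all_order all_algebra.
From mathcomp Require Import all_classical all_reals all_analysis.
From mathcomp Require Import measurable_realfun.
From mathcomp Require Import ring lra zify.
Set Implicit Arguments.
Unset Strict Implicit.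
Unset Printing Implicit Defensive.
Import Order.TTheory GRing.Theory Num.Theory.
Import numFieldNormedType.Exports.
Local Open Scope classical_set_scope.
Local Open Scope ring_scope.

(** Time runs along one axis of the plane, so the walk keeps meeting fresh
    environment.  A ball that meets two time slabs separated by a gap $g$ has
    radius at least $g/2$, and with $\alpha \ge 20$ such balls are rare: inside a
    box of size $N$ the colours in the two slabs differ from independent ones by
    $O(N^2 g^{-16})$ ([field_prob_mix]).  Up to what happens during the gap, the
    walk at time $n + g + m$ is therefore the sum of two independent copies of
    the walk, at times $n$ and $m$.

    The gap is the delicate point, since its colours depend on the later ones.
    But the walk moves by at most $g$ during the gap, and walks in a common
    environment that start at sites of the same parity keep their order.  After
    the gap the walk is thus squeezed between the walks started at distance $g$
    on either side, and by stationarity the mean distance of these two stays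
    $2g$ ([walk_law_gap]).  In terms of $R_n(\theta)$, the squared modulus of the
    characteristic function of $X_n$, this gives
    $R_{n+g+m}(\theta) \le R_n(\theta) R_m(\theta) + O(\theta g + \dots)$
    ([char_sq_gap]).

    This is iterated over scales.  If $R_n(\theta) \le 1/2$ for $n$ in
    $[a, 16a]$, then $R_n(\theta/2) \le 7/8$ at the same times, and three or four
    doublings of the time bring the bound back to $1/2$ on $[16a, 256a]$
    ([char_sq_level]).  The gap doubles from one level to the next, so the cost
    $\theta g$ stays a small constant and the decoupling error decreases.  At the
    first level the times are bounded, and for $\delta$ small the walk is there
    close to the simple random walk ([char_sq_base]).  Hence at times of order
    $16^j$ the bound $1/2$ holds for some $\theta$ of order $2^{-j}$, which keeps
    $X_n$ from concentrating on $[-2^j, 2^j]$; this is the claim for large $n$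
    ([walk_spread]).  For the finitely many other $n$ it is enough that all steps
    may go to the right.

    Both properties of the environment that are used, stationarity and
    decoupling, are read off from the intensity of the balls.  Cut the weight
    interval into $K$ levels.  With probability $1 - O(1/K)$ each level holds at
    most one ball that covers one of finitely many given sites, and then the
    colours at these sites are obtained by stacking $K$ independent marks, the
    mark of a ball being the pattern of sites that it covers, with its colour
    ([field_prob_near]).  The law of the marks depends on the intensity alone.
    Translation invariance of the intensity passes to the colours
    ([field_prob_translate]), and marks that meet two regions are as rare as
    large balls; in both cases one lets $K$ tend to infinity. *)

(** * Bounds for sine and cosine *)

Section Trigonometry.
Context (R : realType).
Implicit Types x y : R.

Lemma sin_mvt x y : exists c, sin y - sin x = cos c * (y - x).
Proof.
wlog xy : x y / x <= y => [H|].
  have [/H//|/ltW/H[c e]] := leP x y.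
  by exists c; rewrite -opprB e; ring.
have [|c _ e] := @MVT_segment R (@sin R) (@cos R) x y xy.
  exact/continuous_subspaceT/continuous_sin.
by exists c.
Qed.

Lemma cos_mvt x y : exists c, cos y - cos x = - sin c * (y - x).
Proof.
wlog xy : x y / x <= y => [H|].
  have [/H//|/ltW/H[c e]] := leP x y.
  by exists c; rewrite -opprB e; ring.
have [|c _ e] := @MVT_segment R (@cos R) (- sin) x y xy.
  exact/continuous_subspaceT/continuous_cos.
by exists c.
Qed.

Lemma cos_lip x y : `|cos y - cos x| <= `|y - x|.
Proof.
by have [c ->] := cos_mvt x y; rewrite normrM normrN ler_piMl// sin_max.
Qed.

Lemma sin_lip x y : `|sin y - sin x| <= `|y - x|.
Proof.
by have [c ->] := sin_mvt x y; rewrite normrM ler_piMl// cos_max.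
Qed.

(** By the mean value theorem, since $\cos \ge 1/2$ on $[0, 1/2]$. *)
Lemma sin_ge_half x : 0 <= x -> x <= 2^-1 -> x / 2 <= sin x.
Proof.
move=> x0 x2; have xx: - x <= x by lra.
have [c cx e] : exists2 c, c \in `[0, x] & sin x - sin 0 = cos c * (x - 0).
  have [|c cx e] := @MVT_segment R (@sin R) (@cos R) 0 x x0.
    exact/continuous_subspaceT/continuous_sin.
  by exists c.
move: e; rewrite sin0 !subr0 => ->.
have : `|cos c - cos 0| <= `|c - 0| by exact: cos_lip.
move: cx; rewrite in_itv/= => /andP[c0 cx].
rewrite cos0 subr0 (ger0_norm c0) ler_norml => /andP[] h _.
rewrite mulrC; apply: ler_wpM2r => //; lra.
Qed.

Lemma cos_le_sqr x : 0 <= x -> x <= 1 -> cos x <= 1 - x ^+ 2 / 8.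
Proof.
move=> x0 x1; have -> : cos x = 1 - 2 * sin (x / 2) ^+ 2.
  rewrite [in LHS](_ : x = (x / 2) *+ 2); last by lra.
  by rewrite cos_mulr2n cos2sin2; ring.
have : x / 2 / 2 <= sin (x / 2) by apply: sin_ge_half; lra.
move=> h; have : (x / 2 / 2) ^+ 2 <= sin (x / 2) ^+ 2.
  by rewrite lerXn2r ?nnegrE//; lra.
by rewrite !exprMn; lra.
Qed.

(** Bernoulli's inequality, in the form $(1 - q)^n (1 + q)^n \le 1$ with $(1 +
    q)^n \ge 1 + nq \ge 2$ for $q = x^2/8$. *)
Lemma cos_pow_le_half x n : 0 <= x -> x <= 1 -> 8 <= n%:R * x ^+ 2 ->
  0 <= cos x ^+ n <= 2^-1.
Proof.
move=> x0 x1 nx; have c0 : 0 <= cos x.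
  have := cos_lip x 0; rewrite cos0 sub0r normrN (ger0_norm x0) ler_norml.
  by move=> /andP[]; lra.
rewrite exprn_ge0//=.
pose q := x ^+ 2 / 8.
have q0 : 0 <= q by rewrite /q divr_ge0// sqr_ge0.
have q1 : q <= 1.
  rewrite /q; have : x ^+ 2 <= 1 by rewrite exprn_ile1.
  lra.
have H1 : cos x ^+ n <= (1 - q) ^+ n.
  by rewrite lerXn2r ?nnegrE//; [lra|exact: cos_le_sqr].
have H2 : (1 - q) ^+ n * (1 + q) ^+ n <= 1.
  rewrite -exprMn; apply: exprn_ile1; first by apply: mulr_ge0; lra.
  by rewrite (_ : _ * _ = 1 - q ^+ 2); [rewrite gerBl sqr_ge0|ring].
have H3 : forall m, 1 + m%:R * q <= (1 + q) ^+ m.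
  elim=> [|m IH]; first by rewrite mul0r addr0 expr0.
  rewrite exprS -natr1; have m0 : 0 <= m%:R * q * q by rewrite !mulr_ge0.
  apply: (@le_trans _ _ ((1 + q) * (1 + m%:R * q))); first by lra.
  by apply: ler_wpM2l => //; lra.
have H4 : 2 <= (1 + q) ^+ n.
  apply: le_trans (H3 n); have : 1 <= n%:R * q by rewrite /q mulrA; lra.
  lra.
have H5 : 0 <= (1 - q) ^+ n by apply: exprn_ge0; lra.
have : (1 - q) ^+ n * 2 <= (1 - q) ^+ n * (1 + q) ^+ n by apply: ler_wpM2l.
lra.
Qed.

End Trigonometry.

(** * The walk in a fixed environment *)

Section QuenchedWalk.
Context (R : realType).
Implicit Types (u : int -> nat -> R) (h : int -> R) (k m n : nat) (x y : int).

Definition step_mean (p : R) h x : R := p * h (x + 1) + (1 - p) * h (x - 1).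

(** The mean of $h$ after $m$ steps of the walk that is at $x$ at time $k$,
    where $u\,y\,t$ is the probability to go right from $y$ at time $t$. *)
Fixpoint walk_mean u k m h x : R :=
  if m is m'.+1 then step_mean (u x k) (walk_mean u k.+1 m' h) x else h x.

Lemma eq_walk_mean u k m h h' x : h =1 h' -> walk_mean u k m h x = walk_mean u k m h' x.
Proof.
by move=> e; elim: m k x => [|m IH] k x //=; rewrite /step_mean !IH.
Qed.

Lemma walk_mean_add u k m n h x :
  walk_mean u k (m + n) h x = walk_mean u k m (walk_mean u (k + m) n h) x.
Proof.
elim: m k x => [|m IH] k x /=; first by rewrite addn0.
by rewrite /step_mean !IH addSnnS.
Qed.

Lemma walk_mean_lin u k m (a b : R) h1 h2 x :
  walk_mean u k m (fun y => a * h1 y + b * h2 y) x =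
  a * walk_mean u k m h1 x + b * walk_mean u k m h2 x.
Proof.
by elim: m k x => [|m IH] k x //=; rewrite /step_mean !IH; ring.
Qed.

Lemma walk_mean_cst u k m (c : R) x : walk_mean u k m (fun=> c) x = c.
Proof. by elim: m k x => [|m IH] k x //=; rewrite /step_mean !IH; ring. Qed.

(** Only the sites $x - m + 2i$ with $0 \le i \le m$ can be reached from $x$ in
    $m$ steps. The comparison of two starting points rests on this parity, hence
    the form of the hypothesis. *)
Lemma walk_mean_le u k m h1 h2 x : (forall y n, 0 <= u y n <= 1) ->
  (forall i, (i <= m)%N -> h1 (x - m%:Z + (i.*2)%:Z) <= h2 (x - m%:Z + (i.*2)%:Z)) ->
  walk_mean u k m h1 x <= walk_mean u k m h2 x.
Proof.
move=> u01; elim: m k x => [|m IH] k x H /=.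
  by have := H 0%N (leqnn _); rewrite double0 subr0 addr0.
have /andP[u0 u1] := u01 x k.
apply: lerD; apply: ler_wpM2l; rewrite ?subr_ge0//; apply: IH => i im.
  have := H i.+1 im; rewrite (_ : _ - _ + _ = x + 1 - m%:Z + i.*2%:Z)//; lia.
have := H i (leqW im); rewrite (_ : _ - _ + _ = x - 1 - m%:Z + i.*2%:Z)//; lia.
Qed.

Lemma walk_mean_bound u k m h x (B : R) : (forall y n, 0 <= u y n <= 1) ->
  (forall i, (i <= m)%N -> `|h (x - m%:Z + (i.*2)%:Z)| <= B) ->
  `|walk_mean u k m h x| <= B.
Proof.
move=> u01 H; rewrite ler_norml; apply/andP; split.
  rewrite -(walk_mean_cst u k m (- B) x); apply: walk_mean_le => // i im.
  by have := H i im; rewrite ler_norml => /andP[].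
rewrite -[leRHS](walk_mean_cst u k m B x); apply: walk_mean_le => // i im.
by have := H i im; rewrite ler_norml => /andP[].
Qed.

(** Walks that start two sites apart cannot cross without meeting. *)
Lemma walk_mean_mono2 u k m h x : (forall y n, 0 <= u y n <= 1) ->
  (forall y, h y <= h (y + 2)) ->
  walk_mean u k m h x <= walk_mean u k m h (x + 2).
Proof.
move=> u01 hm; elim: m k x => [|m IH] k x //=.
have /andP[u0 u1] := u01 x k; have /andP[v0 v1] := u01 (x + 2) k.
rewrite /step_mean.
have -> : x + 2 - 1 = x + 1 by lia.
have -> : x + 2 + 1 = x + 1 + 2 by lia.
set f := walk_mean u k.+1 m h.
have H1 : f (x - 1) <= f (x + 1).
  by have := IH k.+1 (x - 1); rewrite (_ : x - 1 + 2 = x + 1)//; lia.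
have H2 : f (x + 1) <= f (x + 1 + 2) by exact: IH.
have H3 : (1 - u x k) * f (x - 1) <= (1 - u x k) * f (x + 1).
  by apply: ler_wpM2l => //; rewrite subr_ge0.
have H4 : u (x + 2) k * f (x + 1) <= u (x + 2) k * f (x + 1 + 2).
  by apply: ler_wpM2l.
lra.
Qed.

Lemma walk_mean_mono u k m h x i : (forall y n, 0 <= u y n <= 1) ->
  (forall y, h y <= h (y + 2)) ->
  walk_mean u k m h x <= walk_mean u k m h (x + i.*2%:Z).
Proof.
move=> u01 hm; elim: i => [|i IH]; first by rewrite addr0.
apply: le_trans IH _.
rewrite (_ : x + i.+1.*2%:Z = x + i.*2%:Z + 2); last lia.
exact: walk_mean_mono2.
Qed.

Definition pos_fun (y : int) : R := y%:~R.

(** For $h$ Lipschitz, $\theta y + h(y)$ and $\theta y - h(y)$ both increase, so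
    by monotonicity the means of $h$ from two starting points differ by no more
    than $\theta$ times the means of the position. *)
Lemma walk_mean_lip u k m h (th : R) x i : (forall y n, 0 <= u y n <= 1) ->
  (forall y, `|h (y + 2) - h y| <= th * 2) ->
  `|walk_mean u k m h x - walk_mean u k m h (x + i.*2%:Z)|
   <= th * (walk_mean u k m pos_fun (x + i.*2%:Z) - walk_mean u k m pos_fun x).
Proof.
move=> u01 hl.
have H1 := @walk_mean_mono u k m (fun y => th * pos_fun y + 1 * h y) x i u01.
have H2 := @walk_mean_mono u k m (fun y => th * pos_fun y + (- 1) * h y) x i u01.
rewrite !walk_mean_lin in H1 H2.
have {}H1 := H1 _; have {}H2 := H2 _.
have e y : pos_fun (y + 2) = pos_fun y + 2 by rewrite /pos_fun intrD.
rewrite ler_norml; apply/andP; split.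
  have : forall y, th * pos_fun y + -1 * h y <= th * pos_fun (y + 2) + -1 * h (y + 2).
    by move=> y; have := hl y; rewrite e ler_norml; lra.
  by move=> /H2; lra.
have : forall y, th * pos_fun y + 1 * h y <= th * pos_fun (y + 2) + 1 * h (y + 2).
  by move=> y; have := hl y; rewrite e ler_norml; lra.
by move=> /H1; lra.
Qed.

Lemma eq_walk_mean_env u u' k m h x :
  (forall y t, (k <= t < k + m)%N -> (`|y - x| < m)%N -> u y t = u' y t) ->
  walk_mean u k m h x = walk_mean u' k m h x.
Proof.
elim: m k x => [|m IH] k x H //=.
rewrite /step_mean H ?subrr//; [|lia].
have IH' y : (`|y - x| <= 1)%N -> walk_mean u k.+1 m h y = walk_mean u' k.+1 m h y.
  by move=> yx; apply: IH => z t zt zx; apply: H; lia.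
by rewrite !IH'//; lia.
Qed.

Lemma walk_mean_shift u k m h x (v : int) t :
  walk_mean u (k + t) m h (x + v) =
  walk_mean (fun y s => u (y + v) (s + t)%N) k m (fun y => h (y + v)) x.
Proof.
elim: m k x => [|m IH] k x //=.
have e1 : x + v + 1 = x + 1 + v by lia.
have e2 : x + v - 1 = x - 1 + v by lia.
rewrite /step_mean e1 e2.
by rewrite -addSn !IH.
Qed.

Lemma eq_walk_mean_near u k m h h' x :
  (forall y, (`|y - x| <= m)%N -> h y = h' y) ->
  walk_mean u k m h x = walk_mean u k m h' x.
Proof.
elim: m k x => [|m IH] k x H /=; first by apply: H; lia.
by rewrite /step_mean !(IH k.+1) // => y yx; apply: H; lia.
Qed.

Lemma walk_mean_pos_bound u k m x : (forall y n, 0 <= u y n <= 1) ->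
  `|walk_mean u k m pos_fun x - x%:~R| <= m%:R.
Proof.
move=> u01.
have -> : walk_mean u k m pos_fun x - x%:~R =
    walk_mean u k m (fun y => 1 * pos_fun y + (- x%:~R) * 1) x.
  by rewrite walk_mean_lin walk_mean_cst; ring.
apply: walk_mean_bound => // i im.
rewrite mul1r mulr1 /pos_fun -intrB -intr_norm.
rewrite (_ : m%:R = m%:Z%:~R)// ler_int; lia.
Qed.

End QuenchedWalk.

(** * The annealed walk over a decoupling field *)

(** The colours at the sites of space-time: [None] where there is no top ball. *)
Definition sign_field := int -> nat -> option bool.

Section SignField.
Context (R : realType).
Implicit Types (e : sign_field) (h : int -> R).

Definition sign_val (o : option bool) : R :=
  if o is Some c then (if c then 1 else -1) else 0.

Lemma sign_val_bound o : `|sign_val o| <= 1.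
Proof. by case: o => [[]|] /=; rewrite ?normrN ?normr1 ?normr0. Qed.

Definition up_of (delta : R) e : int -> nat -> R :=
  fun x t => 2^-1 + delta * sign_val (e x t).

Lemma up_of01 delta e x t : 0 <= delta <= 2^-1 -> 0 <= up_of delta e x t <= 1.
Proof.
move=> /andP[d0 d2]; rewrite /up_of.
by case: (e x t) => [[]|] /=; rewrite ?mulr1 ?mulr0 ?mulrN1; lra.
Qed.

(** Expectation over a random colour field, as a functional: $E_N$ applies to
    functions that read the field in the box $[-N, N] \times [0, N)$ only. The
    field is stationary by [fl_shift]; by [fl_mix] its parts before time $n$ and
    from time $n + g$ on are nearly independent, as $E_N(E_N \Phi)$ evaluates
    $\Phi$ at two independent copies. The power 16 of the gap outweighs the
    powers of $N$ that multiply it in the iteration over scales. *)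
Record field_law (D : R) (E : nat -> (sign_field -> R) -> R) : Prop := {
  fl_lin : forall N (a b : R) F G,
    E N (fun e => a * F e + b * G e) = a * E N F + b * E N G ;
  fl_one : forall N, E N (fun=> 1) = 1 ;
  fl_le : forall N F G, (forall e, F e <= G e) -> E N F <= E N G ;
  fl_shift : forall N N' (x : int) t F,
    (forall e e', (forall y s, (`|y| <= N)%N -> (s < N)%N -> e y s = e' y s) ->
       F e = F e') ->
    (`|x| + N <= N')%N -> (t + N <= N')%N ->
    E N' (fun e => F (fun y s => e (y + x) (s + t)%N)) = E N F ;
  fl_mix : forall N n g Phi (B : R), (1 < g)%N ->
    (forall e e', `|Phi e e'| <= B) ->
    (forall e1 e1' e2 e2',
       (forall y s, (s < n)%N -> e1 y s = e1' y s) ->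
       (forall y s, (n + g <= s)%N -> e2 y s = e2' y s) ->
       Phi e1 e2 = Phi e1' e2') ->
    `|E N (fun e => Phi e e) - E N (fun e => E N (Phi e))| <=
    B * (D * N%:R ^+ 2 / g%:R ^+ 16) }.

End SignField.

Section AnnealedWalk.
Context (R : realType) (D : R) (E : nat -> (sign_field -> R) -> R).
Context (EP : field_law D E) (delta : R) (delta01 : 0 <= delta <= 2^-1).
Implicit Types (e : sign_field) (h : int -> R).

Local Notation u := (up_of delta).
Local Notation pos := (@pos_fun R).

Let u01 e y t : 0 <= u e y t <= 1. Proof. exact: up_of01. Qed.

Lemma field_cst N (c : R) : E N (fun=> c) = c.
Proof.
have := fl_lin EP N c 0 (fun=> 1) (fun=> 1).
rewrite (fl_one EP) mulr1 mul0r addr0 => e; rewrite -[RHS]e.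
by congr (E N _); apply/funext => e'; ring.
Qed.

Lemma fieldB N F G : E N (fun e => F e - G e) = E N F - E N G.
Proof.
have := fl_lin EP N 1 (-1) F G; rewrite mul1r mulN1r => <-.
by congr (E N _); apply/funext => e; ring.
Qed.

Lemma fieldZ N (a : R) F : E N (fun e => a * F e) = a * E N F.
Proof.
have := fl_lin EP N a 0 F F; rewrite mul0r addr0 => <-.
by congr (E N _); apply/funext => e; ring.
Qed.

Lemma field_norm N F G : (forall e, `|F e| <= G e) -> `|E N F| <= E N G.
Proof.
move=> H; rewrite ler_norml; apply/andP; split; last first.
  by apply: (fl_le EP) => e; have := H e; rewrite ler_norml => /andP[].
rewrite -[leLHS]mulN1r -fieldZ; apply: (fl_le EP) => e.
by have := H e; rewrite mulN1r ler_norml => /andP[].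
Qed.

Lemma field_walk_mean N v k m (H : sign_field -> int -> R) x :
  E N (fun e => walk_mean v k m (H e) x) =
  walk_mean v k m (fun y => E N (fun e => H e y)) x.
Proof.
by elim: m k x => [|m IH] k x //=; rewrite /step_mean (fl_lin EP) !IH.
Qed.

(** The annealed expectation of $h(X_n)$. *)
Definition walk_law n h : R := E n (fun e => walk_mean (u e) 0 n h 0).

Lemma walk_law_lin n (a b : R) h1 h2 :
  walk_law n (fun y => a * h1 y + b * h2 y) = a * walk_law n h1 + b * walk_law n h2.
Proof.
rewrite /walk_law -(fl_lin EP); congr (E n _); apply/funext => e.
by rewrite walk_mean_lin.
Qed.

Lemma walk_law_cst n (c : R) : walk_law n (fun=> c) = c.
Proof.
rewrite /walk_law -[RHS](field_cst n); congr (E n _); apply/funext => e.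
by rewrite walk_mean_cst.
Qed.

Lemma walk_law_le n h1 h2 : (forall x, (`|x| <= n)%N -> h1 x <= h2 x) ->
  walk_law n h1 <= walk_law n h2.
Proof.
move=> H; apply: (fl_le EP) => e; apply: walk_mean_le => // i im.
by apply: H; lia.
Qed.

Lemma eq_walk_law n h1 h2 : h1 =1 h2 -> walk_law n h1 = walk_law n h2.
Proof. by move=> /funext ->. Qed.

Lemma field_walk_shift N n m h (z : int) :
  (`|z| + m <= N)%N -> (n + m <= N)%N ->
  E N (fun e => walk_mean (u e) n m h z) = walk_law m (fun y => h (y + z)).
Proof.
move=> zN nN; rewrite /walk_law.
rewrite -[RHS](fl_shift EP (N' := N) (x := z) (t := n)) //.
  congr (E N _); apply/funext => e.
  by rewrite -{1}[z]add0r -{1}[n]add0n walk_mean_shift.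
by move=> e e' ee'; apply: eq_walk_mean_env => y t tm ym; rewrite /up_of ee'//; lia.
Qed.

Definition mix_err N g : R := D * N%:R ^+ 2 / g%:R ^+ 16.

(** During the gap of length $g$ the walk stays between the sites at distance
    $g$ on either side of $X_n$. By stationarity the walks that start from these
    two sites when the gap ends keep the mean distance $2g$, so by
    [walk_mean_lip] replacing the walk by the right one costs $2 g \theta$. The
    environment after the gap is nearly fresh, so the right walk adds an
    independent copy of $X_m$. *)
Lemma walk_law_gap n g m h (th : R) : (1 < g)%N -> 0 <= th ->
  (forall y, `|h y| <= 1) -> (forall y, `|h (y + 2) - h y| <= th * 2) ->
  `|walk_law (n + g + m) h -
    walk_law n (fun x => walk_law m (fun y => h (y + (x + g%:Z))))| <=
  th * (2 * g%:R) + (1 + th * (2 * g%:R + 2 * m%:R)) * mix_err (n + g + m) g.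
Proof.
move=> g1 th0 h1 hlip; set N := (n + g + m)%N.
pose H e := walk_mean (u e) (n + g) m h.
pose I e := walk_mean (u e) (n + g) m pos.
pose Phi e e' := walk_mean (u e) 0 n (fun x => H e' (x + g%:Z)) 0.
pose Psi e e' := walk_mean (u e) 0 n (fun x => I e' (x + g%:Z) - I e' (x - g%:Z)) 0.
have local (f : int -> R) (e e' : sign_field) x :
    (forall y s, (n + g <= s)%N -> e y s = e' y s) ->
    walk_mean (u e) (n + g) m f x = walk_mean (u e') (n + g) m f x.
  by move=> ee; apply: eq_walk_mean_env => y t tm _; rewrite /up_of ee//; lia.
have locPast (f : int -> R) (e e' : sign_field) x :
    (forall y s, (s < n)%N -> e y s = e' y s) ->
    walk_mean (u e) 0 n f x = walk_mean (u e') 0 n f x.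
  by move=> ee; apply: eq_walk_mean_env => y t tm _; rewrite /up_of ee//; lia.
have step1 : `|walk_law N h - E N (fun e => Phi e e)| <=
    th * E N (fun e => Psi e e).
  rewrite /walk_law -fieldB -fieldZ; apply: field_norm => e.
  rewrite /N -addnA walk_mean_add add0n.
  rewrite (eq_walk_mean _ _ _ _ (walk_mean_add _ _ _ _ _)) /Phi /Psi -/(H e).
  set A := walk_mean _ _ _ _ _; set B := walk_mean _ _ _ _ _.
  have -> : A - B = walk_mean (u e) 0 n (fun x =>
      1 * walk_mean (u e) n g (H e) x + (-1) * H e (x + g%:Z)) 0.
    by rewrite walk_mean_lin -/A -/B; ring.
  set C := (X in _ <= _ * X).
  have -> : th * C = walk_mean (u e) 0 n (fun x =>
      th * (I e (x + g%:Z) - I e (x - g%:Z)) + 0 * 0) 0.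
    by rewrite walk_mean_lin -/C; ring.
  have key x : `|1 * walk_mean (u e) n g (H e) x + -1 * H e (x + g%:Z)| <=
      th * (I e (x + g%:Z) - I e (x - g%:Z)) + 0 * 0.
    have -> : 1 * walk_mean (u e) n g (H e) x + -1 * H e (x + g%:Z) =
        walk_mean (u e) n g (fun y => 1 * H e y + (- H e (x + g%:Z)) * 1) x.
      by rewrite walk_mean_lin walk_mean_cst; ring.
    apply: walk_mean_bound => // i ig; rewrite mul1r mulr1 mul0r addr0.
    set y := x - _ + _.
    have -> : x + g%:Z = y + (g - i).*2%:Z by rewrite /y; lia.
    apply: le_trans (walk_mean_lip (th := th) _ _ _ _ _ _) _ => //.
    apply: ler_wpM2l => //; apply: lerB => //.
    by apply: walk_mean_mono => // z; rewrite /pos_fun ler_int; lia.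
  pose F x := th * (I e (x + g%:Z) - I e (x - g%:Z)) + 0 * 0.
  rewrite ler_norml; apply/andP; split.
    rewrite -/F (_ : - _ = walk_mean (u e) 0 n (fun x => (-1) * F x + 0 * 0) 0).
      apply: walk_mean_le => // i _; rewrite /F.
      by move: (key (0 - n%:Z + i.*2%:Z)); rewrite ler_norml => /andP[]; lra.
    by rewrite (walk_mean_lin _ _ _ _ _ F (fun=> 0)); ring.
  apply: walk_mean_le => // i _.
  by move: (key (0 - n%:Z + i.*2%:Z)); rewrite ler_norml => /andP[]; lra.
have step2 : `|E N (fun e => Phi e e) - E N (fun e => E N (Phi e))| <= 1 * mix_err N g.
  apply: (@fl_mix _ _ _ EP N n g Phi) => //.
    by move=> e e'; apply: walk_mean_bound => // i _; apply: walk_mean_bound.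
  move=> e1 e1' e2 e2' E1 E2; rewrite /Phi (locPast _ _ _ _ E1).
  by apply: eq_walk_mean => x; exact: local.
have step3 : `|E N (fun e => Psi e e) - E N (fun e => E N (Psi e))| <=
    (2 * g%:R + 2 * m%:R) * mix_err N g.
  apply: (@fl_mix _ _ _ EP N n g Psi) => //.
    move=> e e'; apply: walk_mean_bound => // i _.
    set x := 0 - _ + _.
    have := walk_mean_pos_bound (n + g) m (x + g%:Z) (u01 e').
    have := walk_mean_pos_bound (n + g) m (x - g%:Z) (u01 e').
    rewrite -/(I e') (intrD _ x g%:Z) (intrB _ x g%:Z) !ler_norml (_ : g%:Z%:~R = g%:R :> R)//.
    move=> /andP[? ?] /andP[? ?]; apply/andP; split; have := ler0n R g; have := ler0n R m; lra.
  move=> e1 e1' e2 e2' E1 E2; rewrite /Psi (locPast _ _ _ _ E1).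
  by apply: eq_walk_mean => x; rewrite /I !(local _ _ _ _ E2).
have indep (f : int -> R) (s : int) e : (`|s| <= g)%N ->
    E N (fun e' => walk_mean (u e) 0 n (fun x => walk_mean (u e') (n + g) m f (x + s)) 0) =
    walk_mean (u e) 0 n (fun x => walk_law m (fun y => f (y + (x + s)))) 0.
  move=> sg; rewrite field_walk_mean; apply: eq_walk_mean_near => x xn.
  by apply: field_walk_shift; rewrite /N; lia.
have ePhi : E N (fun e => E N (Phi e)) =
    walk_law n (fun x => walk_law m (fun y => h (y + (x + g%:Z)))).
  transitivity (E N (fun e => walk_mean (u e) 0 n
      (fun x => walk_law m (fun y => h (y + (x + g%:Z)))) 0)).
    by congr (E N _); apply/funext => e; apply: indep; lia.
  rewrite field_walk_shift /N; [|lia|lia].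
  by apply: eq_walk_law => x; rewrite addr0.
have ePsi : E N (fun e => E N (Psi e)) = 2 * g%:R.
  transitivity (E N (fun=> 2 * g%:R)); last exact: field_cst.
  congr (E N _); apply/funext => e.
  transitivity (walk_mean (u e) 0 n (fun x => 1 * walk_law m (fun y => pos (y + (x + g%:Z)))
      + (-1) * walk_law m (fun y => pos (y + (x - g%:Z)))) 0).
    rewrite walk_mean_lin -!indep; [|lia|lia].
    rewrite mul1r mulN1r -fieldB; congr (E N _); apply/funext => e'.
    rewrite -[RHS]/(_ + - _).
    set A := walk_mean _ _ _ _ _; set B := walk_mean _ _ _ _ _.
    rewrite (_ : A + - B = 1 * A + (-1) * B); last by ring.
    by rewrite -walk_mean_lin /Psi; apply: eq_walk_mean => x; rewrite /I; ring.
  rewrite -[RHS](walk_mean_cst (u e) 0 n _ 0); apply: eq_walk_mean => x.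
  have sh (z : int) : walk_law m (fun y => pos (y + z)) = walk_law m pos + z%:~R.
    rewrite -[X in _ = X + _]mul1r -[z%:~R]mulr1 -{3}(walk_law_cst m 1) -walk_law_lin.
    by apply: eq_walk_law => y; rewrite /pos_fun intrD; ring.
  by rewrite !sh (intrD _ x g%:Z) (intrB _ x g%:Z) (_ : g%:Z%:~R = g%:R :> R)//; ring.
rewrite -ePhi; rewrite ePsi in step3.
have {}step3 : th * E N (fun e => Psi e e) <=
    th * (2 * g%:R + (2 * g%:R + 2 * m%:R) * mix_err N g).
  by apply: ler_wpM2l => //; move: step3; rewrite ler_norml => /andP[]; lra.
have := ler_normD (walk_law N h - E N (fun e => Phi e e))
  (E N (fun e => Phi e e) - E N (fun e => E N (Phi e))).
rewrite addrA subrK; lra.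
Qed.

End AnnealedWalk.

(** * Characteristic function of the annealed walk *)

Section CharacteristicFunction.
Context (R : realType) (D : R) (E : nat -> (sign_field -> R) -> R).
Context (EP : field_law D E) (delta : R) (delta01 : 0 <= delta <= 2^-1).
Context (D_ge0 : 0 <= D).
Local Notation law := (walk_law E delta).

Definition cos_at (th : R) (x : int) : R := cos (th * x%:~R).
Definition sin_at (th : R) (x : int) : R := sin (th * x%:~R).

(** The squared modulus of the characteristic function of $X_n$. *)
Definition char_sq (th : R) n : R := law n (cos_at th) ^+ 2 + law n (sin_at th) ^+ 2.

(** It is also the characteristic function of the difference of two independent
    copies of $X_n$. *)
Lemma char_sqE th n :
  char_sq th n = law n (fun x => law n (fun y => cos (th * (x - y)%:~R))).
Proof.
transitivity (law n (fun x => law n (cos_at th) * cos_at th x +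
    law n (sin_at th) * sin_at th x)).
  by rewrite (walk_law_lin EP) /char_sq !expr2.
apply: eq_walk_law => x.
transitivity (law n (fun y => cos_at th x * cos_at th y + sin_at th x * sin_at th y)).
  by rewrite (walk_law_lin EP); ring.
by apply: eq_walk_law => y; rewrite /cos_at /sin_at intrB mulrBr cosB.
Qed.

Lemma char_sq_ge0 th n : 0 <= char_sq th n.
Proof. by rewrite addr_ge0// sqr_ge0. Qed.

Lemma char_sq_le1 th n : char_sq th n <= 1.
Proof.
rewrite char_sqE -[leRHS](walk_law_cst EP delta n).
apply: (walk_law_le EP) => // x _; rewrite -[leRHS](walk_law_cst EP delta n).
by apply: (walk_law_le EP) => // y _; exact: cos_le1.
Qed.

(** This is $1 - \cos 2t \le 4 (1 - \cos t)$, averaged over the difference of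
    two independent copies of $X_n$. *)
Lemma char_sq_halve th n : 1 - char_sq (2 * th) n <= 4 * (1 - char_sq th n).
Proof.
pose F (th' : R) (x y : int) : R := cos (th' * (x - y)%:~R).
have key x y : 4 * F th x y + (- 3) * 1 <= F (2 * th) x y.
  rewrite /F; set t := _%:~R.
  rewrite (_ : 2 * th * t = (th * t) *+ 2); last by ring.
  have := sqr_ge0 (cos (th * t) - 1).
  rewrite cos_mulr2n sqrrB1 mulr2n; lra.
have key1 x : 4 * law n (F th x) + (- 3) * 1 <= law n (F (2 * th) x).
  rewrite (_ : _ + _ = law n (fun y => 4 * F th x y + (- 3) * 1)).
    exact: (walk_law_le EP).
  by rewrite (walk_law_lin EP) (walk_law_cst EP).
suff : 4 * char_sq th n + (- 3) * law n (fun=> 1) <= char_sq (2 * th) n.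
  by rewrite (walk_law_cst EP); lra.
by rewrite !char_sqE -(walk_law_lin EP); apply: (walk_law_le EP) => // x _; exact: key1.
Qed.

Lemma cos_at_lip th x y : 0 <= th -> `|cos_at th y - cos_at th x| <= th * `|y - x|%:~R.
Proof.
move=> th0; apply: le_trans (cos_lip _ _) _.
by rewrite -mulrBr normrM (ger0_norm th0) -intrB intr_norm.
Qed.

Lemma sin_at_lip th x y : 0 <= th -> `|sin_at th y - sin_at th x| <= th * `|y - x|%:~R.
Proof.
move=> th0; apply: le_trans (sin_lip _ _) _.
by rewrite -mulrBr normrM (ger0_norm th0) -intrB intr_norm.
Qed.

Lemma sqr_near (a b e : R) : `|a - b| <= e -> `|b| <= 1 -> a ^+ 2 <= b ^+ 2 + 2 * e + e ^+ 2.
Proof.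
move=> abe b1; have e0 : 0 <= e := le_trans (normr_ge0 _) abe.
have -> : a ^+ 2 = b ^+ 2 + 2 * (b * (a - b)) + (a - b) ^+ 2 by ring.
apply: lerD.
  rewrite lerD2l ler_pM2l//; apply: le_trans (ler_norm _) _.
  by rewrite normrM -[leRHS]mul1r ler_pM.
by rewrite -real_normK ?num_real// lerXn2r ?nnegrE.
Qed.

(** The characteristic function of $X_n + g + X'_m$, with $X'_m$ an independent
    copy, is the product of those of $X_n$ and $X_m$ up to a rotation. An error
    of $1/125$ in real and imaginary part changes the squared modulus by at most
    $4/125 + 2/125^2 \le 1/30$. *)
Lemma char_sq_gap n g m th : (1 < g)%N -> 0 <= th ->
  th * (2 * g%:R) + (1 + th * (2 * g%:R + 2 * m%:R)) * mix_err D (n + g + m) g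
    <= 125^-1 ->
  char_sq th (n + g + m) <= char_sq th n * char_sq th m + 30^-1.
Proof.
move=> g1 th0; set err := (X in X <= _ -> _) => err_le.
set c := cos (th * g%:R); set s := sin (th * g%:R).
have cs : c ^+ 2 + s ^+ 2 = 1 by exact: cos2Dsin2.
set C1 := law n (cos_at th); set S1 := law n (sin_at th).
set C2 := law m (cos_at th); set S2 := law m (sin_at th).
(* The real and imaginary parts of the characteristic function of $X_n + g$. *)
pose Cg := C1 * c - S1 * s; pose Sg := S1 * c + C1 * s.
have eC : law n (fun x => law m (fun y => cos_at th (y + (x + g%:Z)))) =
    Cg * C2 - Sg * S2.
  transitivity (law n (fun x => (C2 * c - S2 * s) * cos_at th x +
     (- (C2 * s) - S2 * c) * sin_at th x)).
    apply: eq_walk_law => x.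
    transitivity (law m (fun y => (cos_at th x * c - sin_at th x * s) * cos_at th y +
       (- (sin_at th x * c) - cos_at th x * s) * sin_at th y)).
      apply: eq_walk_law => y; rewrite /cos_at !intrD !mulrDr addrA.
      rewrite (_ : g%:Z%:~R = g%:R)// !(cosD, sinD) /sin_at /c /s; ring.
    by rewrite (walk_law_lin EP) -/C2 -/S2; ring.
  by rewrite (walk_law_lin EP) -/C1 -/S1 /Cg /Sg; ring.
have eS : law n (fun x => law m (fun y => sin_at th (y + (x + g%:Z)))) =
    Sg * C2 + Cg * S2.
  transitivity (law n (fun x => (C2 * s + S2 * c) * cos_at th x +
     (C2 * c - S2 * s) * sin_at th x)).
    apply: eq_walk_law => x.
    transitivity (law m (fun y => (cos_at th x * s + sin_at th x * c) * cos_at th y +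
       (cos_at th x * c - sin_at th x * s) * sin_at th y)).
      apply: eq_walk_law => y; rewrite /sin_at !intrD !mulrDr addrA.
      rewrite (_ : g%:Z%:~R = g%:R)// !(cosD, sinD) /cos_at /c /s; ring.
    by rewrite (walk_law_lin EP) -/C2 -/S2; ring.
  by rewrite (walk_law_lin EP) -/C1 -/S1 /Cg /Sg; ring.
have prod : (Cg * C2 - Sg * S2) ^+ 2 + (Sg * C2 + Cg * S2) ^+ 2 =
    char_sq th n * char_sq th m.
  rewrite /char_sq -/C1 -/S1 -/C2 -/S2.
  rewrite -[RHS]mul1r -cs /Cg /Sg; ring.
have le1 : (Cg * C2 - Sg * S2) ^+ 2 + (Sg * C2 + Cg * S2) ^+ 2 <= 1.
  by rewrite prod mulr_ile1 ?char_sq_ge0 ?char_sq_le1.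
have sq1 (a b : R) : a ^+ 2 + b ^+ 2 <= 1 -> `|a| <= 1.
  move=> ab; rewrite -(@ler_pXn2r _ 2) ?nnegrE// expr1n real_normK ?num_real//.
  by apply: le_trans ab; rewrite lerDl sqr_ge0.
have H1 := @walk_law_gap R D E EP delta delta01 n g m (cos_at th) th g1 th0
  (fun y => cos_max _).
have H2 := @walk_law_gap R D E EP delta delta01 n g m (sin_at th) th g1 th0
  (fun y => sin_max _).
have {}H1 := sqr_near (H1 _) _; rewrite eC in H1.
have {}H2 := sqr_near (H2 _) _; rewrite eS in H2.
have ad2 (y : int) : `|y + 2 - y|%:~R = 2 :> R by rewrite addrAC subrr add0r.
have {}H1 := H1 _ (sq1 _ _ le1).
have {}H2 := H2 _ (sq1 (Sg * C2 + Cg * S2) (Cg * C2 - Sg * S2) _).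
have {}H1 : law (n + g + m) (cos_at th) ^+ 2 <=
    (Cg * C2 - Sg * S2) ^+ 2 + 2 * err + err ^+ 2.
  by apply: H1 => y; apply: le_trans (cos_at_lip _ _ th0) _; rewrite ad2.
have {}H2 : law (n + g + m) (sin_at th) ^+ 2 <=
    (Sg * C2 + Cg * S2) ^+ 2 + 2 * err + err ^+ 2.
  apply: H2 => [y|]; last by rewrite addrC.
  by apply: le_trans (sin_at_lip _ _ th0) _; rewrite ad2.
have err0 : 0 <= err.
  by rewrite /err /mix_err !(addr_ge0, mulr_ge0, invr_ge0, exprn_ge0).
have : err ^+ 2 <= 125^-1 * err by rewrite expr2 ler_wpM2r.
rewrite -prod {1}/char_sq; lra.
Qed.

(** A time $n$ in the new range is cut into two nearly equal halves separated by
    the gap. *)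
Lemma char_sq_double p q g Nm th rho : (1 < g)%N -> 0 <= th -> 0 <= rho ->
  (forall n, (p <= n <= q)%N -> char_sq th n <= rho) ->
  (2 * q + g <= Nm)%N ->
  th * (2 * g%:R) + (1 + 2 * (th * Nm%:R)) * mix_err D Nm g <= 125^-1 ->
  forall n, (2 * p + g <= n <= 2 * q + g)%N -> char_sq th n <= rho ^+ 2 + 30^-1.
Proof.
move=> g1 th0 rho0 H qN err_le n nN.
pose n1 := ((n - g) %/ 2)%N; pose n2 := (n - g - n1)%N.
have en : (n = n1 + g + n2)%N by rewrite /n2 /n1; lia.
rewrite en; apply: le_trans (char_sq_gap (n := n1) (m := n2) g1 th0 _) _.
  rewrite -en; apply: le_trans err_le; rewrite lerD2l.
  have nNm : n%:R <= Nm%:R :> R by rewrite ler_nat; lia.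
  have gm : g%:R + n2%:R <= Nm%:R :> R by rewrite -natrD ler_nat; lia.
  have gp : 0 < g%:R ^+ 16 :> R by rewrite exprn_gt0// ltr0n; lia.
  apply: ler_pM.
  - by rewrite !(addr_ge0, mulr_ge0).
  - by rewrite /mix_err !(mulr_ge0, invr_ge0, exprn_ge0).
  - rewrite lerD2l mulrCA; have := ler_wpM2l th0 gm; lra.
  - rewrite /mix_err ler_pM2r ?invr_gt0//; apply: ler_wpM2l => //.
    by rewrite lerXn2r ?nnegrE.
rewrite lerD2r expr2; apply: ler_pM; rewrite ?char_sq_ge0//; apply: H.
  by rewrite /n1; lia.
by rewrite /n2 /n1; lia.
Qed.

(** Halving $\theta$ loosens the bound $1/2$ to $7/8$, and three doublings of
    the time restore it because $(7/8)^8$ is below $1/2$ with room for the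
    errors. A fourth doubling keeps it; together they reach every time between
    $16a$ and $256a$. *)
Lemma char_sq_level a g th : (1 < g)%N -> (g <= a)%N -> 0 <= th ->
  th * (2 * g%:R) + (1 + 2 * (th * (300 * a)%:R)) * mix_err D (300 * a) g <= 125^-1 ->
  (forall n, (a <= n <= 16 * a)%N -> char_sq (2 * th) n <= 2^-1) ->
  forall n, (16 * a <= n <= 16 * (16 * a))%N -> char_sq th n <= 2^-1.
Proof.
move=> g1 ga th0 err_le H0.
have H1 n : (a <= n <= 16 * a)%N -> char_sq th n <= 7 / 8.
  by move=> /H0; have := char_sq_halve th n; lra.
have dbl p q rho : 0 <= rho -> (forall n, (p <= n <= q)%N -> char_sq th n <= rho) ->
    (2 * q + g <= 300 * a)%N ->
    forall n, (2 * p + g <= n <= 2 * q + g)%N -> char_sq th n <= rho ^+ 2 + 30^-1.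
  by move=> r0 H qN; exact: (char_sq_double g1 th0 r0 H qN err_le).
(* The bounds after one, two and three doublings: $(7/8)^2 + 1/30 \le 4/5$,
   $(4/5)^2 + 1/30 \le 27/40$ and $(27/40)^2 + 1/30 \le 1/2$. *)
have H2 := dbl _ _ _ _ H1 _; have {}H2 := H2 ltac:(lra) ltac:(lia).
have {}H2 n : (2 * a + g <= n <= 2 * (16 * a) + g)%N -> char_sq th n <= 4 / 5.
  by move=> /H2; lra.
have H3 := dbl _ _ _ _ H2 _; have {}H3 := H3 ltac:(lra) ltac:(lia).
have {}H3 n : (2 * (2 * a + g) + g <= n <= 2 * (2 * (16 * a) + g) + g)%N ->
    char_sq th n <= 27 / 40.
  by move=> /H3; lra.
have H4 := dbl _ _ _ _ H3 _; have {}H4 := H4 ltac:(lra) ltac:(lia).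
have {}H4 n : (2 * (2 * (2 * a + g) + g) + g <= n <=
    2 * (2 * (2 * (16 * a) + g) + g) + g)%N -> char_sq th n <= 2^-1.
  by move=> /H4; lra.
have H5 := dbl _ _ _ _ H4 _; have {}H5 := H5 ltac:(lra) ltac:(lia).
move=> n nr; have [nle|nlt] := leqP n (2 * (2 * (2 * (16 * a) + g) + g) + g).
  by apply: H4; lia.
suff : char_sq th n <= 2^-1 ^+ 2 + 30^-1 by lra.
by apply: H5; lia.
Qed.

(** Without drift one step multiplies the characteristic function by
    $\cos\theta$, and the drift changes the outcome of each step by at most
    $2\delta$. *)
Lemma char_sq_simple n th :
  `|law n (cos_at th) - cos th ^+ n| <= 2 * delta * n%:R /\
  `|law n (sin_at th)| <= 2 * delta * n%:R.
Proof.
have /andP[d0 _] := delta01.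
pose u := up_of delta.
have ctr e k x : `|step_mean (u e x k) (cos_at th) x - cos th * cos_at th x| <= 2 * delta.
  rewrite /step_mean /cos_at intrD intrB !mulrDr mulrN mulr1 cosD cosB.
  set c := cos (th * _); set s := sin (th * _).
  have -> : u e x k * (c * cos th - s * sin th) +
    (1 - u e x k) * (c * cos th + s * sin th) - cos th * c =
    (2 * delta) * (- (sign_val R (e x k) * (s * sin th))).
    by rewrite /u /up_of; field.
  rewrite normrM ger0_norm; last by lra.
  rewrite ler_piMr//; [lra|].
  rewrite normrN !normrM mulr_ile1// ?mulr_ge0// ?sign_val_bound//.
  by rewrite mulr_ile1// sin_max.
have str e k x : `|step_mean (u e x k) (sin_at th) x - cos th * sin_at th x| <= 2 * delta.
  rewrite /step_mean /sin_at intrD intrB !mulrDr mulrN mulr1 sinD sinB.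
  set c := cos (th * _); set s := sin (th * _).
  have -> : u e x k * (s * cos th + c * sin th) +
    (1 - u e x k) * (s * cos th - c * sin th) - cos th * s =
    (2 * delta) * ((sign_val R (e x k) * (c * sin th))).
    by rewrite /u /up_of; field.
  rewrite normrM ger0_norm; last by lra.
  rewrite ler_piMr//; [lra|].
  rewrite !normrM mulr_ile1// ?mulr_ge0// ?sign_val_bound//.
  by rewrite mulr_ile1// ?sin_max// cos_max.
have rec (h : int -> R) k : (forall e t x,
    `|step_mean (u e x t) h x - cos th * h x| <= 2 * delta) ->
    `|law k.+1 h - cos th * law k h| <= 2 * delta.
  move=> H; have <- : E k.+1 (fun e => walk_mean (u e) 0 k h 0) = law k h.
    rewrite /u (field_walk_shift EP)//.
    by apply: eq_walk_law => x; rewrite addr0.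
  rewrite -(fieldZ EP) -(fieldB EP) -[leRHS](field_cst EP k.+1).
  apply: (field_norm EP) => e; rewrite -/(u e) -addn1 walk_mean_add add0n /=.
  set F := fun x => step_mean (u e x k) h x.
  rewrite (_ : _ - _ = walk_mean (u e) 0 k (fun x => 1 * F x + (- cos th) * h x) 0).
    apply: walk_mean_bound => [y t|i _]; first exact: up_of01.
    by rewrite mul1r mulNr; exact: H.
  by rewrite walk_mean_lin mul1r mulNr.
have contr (a b c : R) : `|a| <= 1 -> `|a * b - a * c| <= `|b - c|.
  by move=> a1; rewrite -mulrBr normrM ler_piMl.
elim: n => [|n [IHc IHs]].
  rewrite /char_sq /walk_law.
  have e0 h : E 0 (fun e => walk_mean (u e) 0 0 h 0) = h 0 by rewrite /= (field_cst EP).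
  rewrite !e0 /cos_at /sin_at !mulr0 cos0 sin0 expr0 subrr normr0; split=> //.
have := rec _ n ctr; have := rec _ n str.
have := contr _ (law n (cos_at th)) (cos th ^+ n) (cos_max th).
have := contr _ (law n (sin_at th)) 0 (cos_max th).
rewrite mulr0 !subr0 -exprS -natr1.
set Cn := law n.+1 (cos_at th); set Sn := law n.+1 (sin_at th).
set C := law n (cos_at th); set S := law n (sin_at th).
move=> h1 h2 h3 h4; split.
  by have := ler_normD (Cn - cos th * C) (cos th * C - cos th ^+ n.+1);
    rewrite addrA subrK; lra.
by have := ler_normD (Sn - cos th * S) (cos th * S); rewrite subrK; lra.
Qed.

Lemma char_sq_base n th : 0 <= cos th ^+ n <= 2^-1 -> 2 * delta * n%:R <= 10^-1 ->
  char_sq th n <= 2^-1.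
Proof.
have [hc hs] := char_sq_simple n th; move=> /andP[c0 c1] dn.
have d0 : 0 <= 2 * delta * n%:R by apply: le_trans hs.
have hC : `|law n (cos_at th)| <= 3 / 5.
  by have := ler_normD (law n (cos_at th) - cos th ^+ n) (cos th ^+ n);
    rewrite subrK (ger0_norm c0); lra.
have hS : `|law n (sin_at th)| <= 10^-1 by lra.
have sq (x y : R) : `|x| <= y -> x ^+ 2 <= y ^+ 2.
  move=> xy; rewrite -[x ^+ 2]real_normK ?num_real// lerXn2r ?nnegrE//.
  exact: le_trans xy.
by have := sq _ _ hC; have := sq _ _ hS; rewrite /char_sq; lra.
Qed.

End CharacteristicFunction.

(** * Spread of the walk at all scales *)

Section Scales.
Context (R : realType).

Lemma log_scale A n : (0 < A <= n)%N ->
  exists j, (A * 16 ^ j <= n <= 16 * (A * 16 ^ j))%N.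
Proof.
move=> /andP[A0 An]; have m0 : (0 < n %/ A)%N by rewrite divn_gt0.
have := @trunc_log_bounds 16 (n %/ A) isT m0; set j := trunc_log _ _.
move=> /andP[lo hi]; exists j; rewrite mulnC -leq_divRL// lo/=.
by move: hi; rewrite ltn_divLR// expnS => /ltnW; rewrite -mulnA.
Qed.

Lemma root_le (x y : R) q : (0 < q)%N -> 0 <= x -> 0 <= y -> x <= y ^+ q ->
  x `^ q%:R^-1 <= y.
Proof.
move=> q0 x0 y0 xy.
have -> : y = (y ^+ q) `^ q%:R^-1.
  by rewrite -powR_mulrn// -powRrM mulfV ?pnatr_eq0 -?lt0n// powRr1.
by apply: ge0_ler_powR; rewrite ?nnegrE ?exprn_ge0 ?invr_ge0.
Qed.

Lemma walk_mean_right (u : int -> nat -> R) (p : R) k m h x : 0 <= p ->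
  (forall y t, p <= u y t <= 1) -> (forall y, 0 <= h y) ->
  p ^+ m * h (x + m%:Z) <= walk_mean u k m h x.
Proof.
move=> p0 up h0; elim: m k x => [|m IH] k x /=; first by rewrite expr0 mul1r addr0.
have /andP[pu u1] := up x k.
have W0 : 0 <= walk_mean u k.+1 m h (x - 1).
  rewrite -(walk_mean_cst u k.+1 m 0 (x - 1)); apply: walk_mean_le => // y t.
  by have /andP[? ?] := up y t; rewrite (le_trans p0).
have := IH k.+1 (x + 1); rewrite exprS.
rewrite (_ : x + 1 + m%:Z = x + m.+1%:Z); last lia.
rewrite /step_mean -mulrA; set a := p ^+ m * _ => aW.
have a0 : 0 <= a by rewrite /a mulr_ge0// exprn_ge0.
have h1 : p * a <= u x k * walk_mean u k.+1 m h (x + 1) by apply: ler_pM.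
have h2 : 0 <= (1 - u x k) * walk_mean u k.+1 m h (x - 1).
  by rewrite mulr_ge0// subr_ge0.
lra.
Qed.

Section Levels.
Context (D : R) (E : nat -> (sign_field -> R) -> R) (EP : field_law D E).
Context (delta : R) (delta01 : 0 <= delta <= 2^-1) (D_ge0 : 0 <= D).

Lemma char_sq_levels A G (Th : R) : (1 < G <= A)%N -> 0 <= Th ->
  (forall n, (A <= n <= 16 * A)%N -> char_sq E delta Th n <= 2^-1) ->
  (forall j, Th / 2 ^+ j.+1 * (2 * (G * 2 ^ j)%:R) +
     (1 + 2 * (Th / 2 ^+ j.+1 * (300 * (A * 16 ^ j))%:R)) *
     mix_err D (300 * (A * 16 ^ j)) (G * 2 ^ j) <= 125^-1) ->
  forall j n, (A * 16 ^ j <= n <= 16 * (A * 16 ^ j))%N ->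
    char_sq E delta (Th / 2 ^+ j) n <= 2^-1.
Proof.
move=> /andP[G1 GA] Th0 base err; elim=> [|j IH] n.
  by rewrite expn0 muln1 expr0 divr1; exact: base.
rewrite expnS [X in (X <= _ <= _)%N]mulnCA [X in (_ <= _ <= 16 * X)%N]mulnCA.
apply: (char_sq_level EP delta01 D_ge0 (g := G * 2 ^ j)) => //.
- by rewrite (leq_trans G1)// leq_pmulr// expn_gt0.
- by rewrite leq_mul//; case: (j) => // i; rewrite leq_exp2r.
- by rewrite divr_ge0// exprn_ge0.
- move=> m /IH; congr (char_sq _ _ _ _ <= _); rewrite exprS.
  by field; rewrite expf_neq0// pnatr_eq0.
Qed.

End Levels.

(** At level $j$ the gap is $G 2^j$ and the times are of order $G^2 16^j$, so
    the decoupling error is of order $(G^2 16^j)^3 / (G 2^j)^{16}$: it decreases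
    in $j$ and is small for $G$ large. The cost of the gap is $2 \theta g =
    1/250$ at every level. *)
Lemma level_err (D c : R) A G (Th : R) j : 0 <= D -> 1 <= c -> (0 < G)%N ->
  A%:R = (c * G%:R) ^+ 2 -> Th = (250 * G%:R)^-1 ->
  250 * (3 * D * (300 * c ^+ 2) ^+ 3) <= G%:R ->
  Th / 2 ^+ j.+1 * (2 * (G * 2 ^ j)%:R) +
     (1 + 2 * (Th / 2 ^+ j.+1 * (300 * (A * 16 ^ j))%:R)) *
     mix_err D (300 * (A * 16 ^ j)) (G * 2 ^ j) <= 125^-1.
Proof.
move=> D0 c1 G0 EA ETh GK; rewrite !natrM !natrX EA.
set g : R := G%:R; have g1 : 1 <= g by rewrite ler1n.
set t : R := 2 ^+ j; have t1 : 1 <= t by rewrite exprn_ege1// ler1n.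
have g0 : 0 < g by exact: lt_le_trans g1.
have t0 : 0 < t by exact: lt_le_trans t1.
have e16 : 16 ^+ j = t ^+ 4 :> R by rewrite /t -exprM mulnC exprM; congr (_ ^+ _); ring.
rewrite e16 exprS -/t /mix_err !natrM !natrX EA e16 -/g -/t.
have -> : Th / (2 * t) * (2 * (g * t)) = 250^-1.
  by rewrite ETh -/g; field; rewrite !gt_eqF.
set a : R := 300 * ((c * g) ^+ 2 * t ^+ 4).
have a1 : 1 <= a.
  rewrite /a exprMn.
  have c2 : 1 <= c ^+ 2 by rewrite exprn_ege1.
  have g2 : 1 <= g ^+ 2 by rewrite exprn_ege1.
  have t4 : 1 <= t ^+ 4 by rewrite exprn_ege1.
  have : 1 <= c ^+ 2 * g ^+ 2 * t ^+ 4.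
    by rewrite -[leLHS]mulr1 -[leLHS]mulr1 !ler_pM// ?mulr1// mulr_ege1.
  lra.
have th1 : Th / (2 * t) <= 1.
  rewrite ler_pdivrMr ?mulr_gt0// mul1r ETh -/g.
  have : (250 * g)^-1 <= 1 by rewrite invf_le1; lra.
  lra.
have th0 : 0 <= Th / (2 * t).
  rewrite ETh -/g; apply: divr_ge0; last lra.
  by rewrite invr_ge0; lra.
have gt0 : 0 < (g * t) ^+ 16 by rewrite exprn_gt0// mulr_gt0.
suff : (1 + 2 * (Th / (2 * t) * a)) * (D * a ^+ 2 / (g * t) ^+ 16) <= 250^-1 by lra.
apply: (@le_trans _ _ ((3 * a) * (D * a ^+ 2 / (g * t) ^+ 16))).
  apply: ler_wpM2r.
    by apply: divr_ge0; [apply: mulr_ge0 => //; exact: sqr_ge0|exact: ltW].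
  have : Th / (2 * t) * a <= 1 * a by apply: ler_wpM2r => //; lra.
  lra.
have -> : 3 * a * (D * a ^+ 2 / (g * t) ^+ 16) =
   (3 * D * (300 * c ^+ 2) ^+ 3) / (g ^+ 10 * t ^+ 4).
  by rewrite /a; field; rewrite !gt_eqF.
rewrite ler_pdivrMr ?mulr_gt0 ?exprn_gt0//.
set K := (3 * D * _) in GK *.
have g10 : g <= g ^+ 10 * t ^+ 4.
  rewrite -[leLHS]mulr1; apply: ler_pM; rewrite ?(ltW g0)//  ?(exprn_ege1 4 t1)//.
  by rewrite exprS ler_peMr ?exprn_ege1// ltW.
lra.
Qed.

End Scales.

(** The spread of the walk for any field that is stationary and decouples at the
    rate of [field_law]; $c_2$ and $\xi$ depend on this rate only. *)
Theorem walk_spread (R : realType) (D : R) : 0 <= D ->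
  exists c2 xi : R, [/\ 0 < c2, 0 < xi &
  forall (E : nat -> (sign_field -> R) -> R), field_law D E ->
  forall delta : R, 0 <= delta <= 2^-1 -> delta <= c2 ->
  exists2 c : R, 0 < c & forall n, (1 <= n)%N ->
    c <= walk_law E delta n (fun x => (n%:R `^ xi <= `|x|%:~R)%R%:R)].
Proof.
move=> D0; have [c Ec] : exists c : R, c = 800 by exists 800.
have c1 : 1 <= c by rewrite Ec; lra.
(* The threshold of [level_err] for the initial gap $G$. *)
pose K : R := 250 * (3 * D * (300 * c ^+ 2) ^+ 3).
pose G := (2 + Num.bound K)%N.
have K0 : 0 <= K.
  have x0 : 0 <= 300 * c ^+ 2 by have := sqr_ge0 c; lra.
  by have := mulr_ge0 D0 (exprn_ge0 3 x0); rewrite /K -mulrA; lra.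
have GK : K <= G%:R.
  rewrite /G natrD; have := archi_boundP K0; lra.
have G2 : (1 < G)%N by rewrite /G; lia.
have {K0} [A GA EA] : exists2 A : nat, (G <= A)%N & A%:R = (c * G%:R) ^+ 2.
  exists ((800 * G) ^ 2)%N; last by rewrite natrX natrM Ec.
  by rewrite -mulnn mulnA leq_pmull// !muln_gt0/=; lia.
clearbody G.
have A0 : (0 < A)%N by apply: leq_trans GA; lia.
have g0 : 0 < G%:R :> R by rewrite ltr0n; lia.
have a0 : 0 < A%:R :> R by rewrite ltr0n.
(* The initial $\theta$ makes the gap cost $2 (\theta/2) G = 1/250$. The
   initial time $A = (800 G)^2$ satisfies $A \theta^2 \ge 8$, so that the
   simple random walk has spread by then. *)
pose Th : R := (250 * G%:R)^-1.
have Th0 : 0 < Th by rewrite invr_gt0; lra.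
have Th1 : Th <= 250^-1.
  have : 1 <= G%:R :> R by rewrite ler1n; lia.
  by move=> G1; rewrite lef_pV2 ?posrE; lra.
(* The exponent $\xi = 1/q$ with $2^q \ge 16 A$ and $q \ge 4$ turns $n \le 16 A
   16^j$ into $n^\xi \le 2 \cdot 2^j$. *)
have [q Eq] : exists q, q = (16 * A)%N by exists (16 * A)%N.
have q0 : (0 < q)%N by rewrite Eq muln_gt0.
pose xi : R := q%:R^-1.
have xi0 : 0 < xi by rewrite invr_gt0 ltr0n.
(* For $n \le 16 A$ the accumulated drift $2 \delta n$ is at most $1/10$. *)
pose c2 : R := (320 * A%:R)^-1.
have c20 : 0 < c2 by rewrite invr_gt0; lra.
have c24 : c2 <= 4^-1.
  have : 1 <= A%:R :> R by rewrite ler1n.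
  by move=> A1; rewrite lef_pV2 ?posrE; lra.
exists c2, xi; split=> // E EP delta d01 dc2.
have d0 : 0 <= delta by case/andP: d01.
have level := char_sq_levels EP d01 D0 (A := A) (G := G) (Th := Th).
have {}level j n : (A * 16 ^ j <= n <= 16 * (A * 16 ^ j))%N ->
    char_sq E delta (Th / 2 ^+ j) n <= 2^-1.
  apply: level; rewrite ?G2 ?GA ?(ltW Th0)//.
    move=> m /andP[m1 m2]; apply: (char_sq_base EP) => //.
      apply: cos_pow_le_half; [exact: ltW|lra|].
      have : A%:R * Th ^+ 2 <= m%:R * Th ^+ 2.
        by apply: ler_wpM2r; rewrite ?sqr_ge0// ler_nat.
      have -> : A%:R * Th ^+ 2 = c ^+ 2 / 250 ^+ 2.
        by rewrite EA /Th; field; rewrite gt_eqF.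
      apply: le_trans; rewrite Ec; lra.
    have : m%:R <= 16 * A%:R :> R by rewrite -natrM ler_nat.
    have e : c2 * (16 * A%:R) = 20^-1.
      by rewrite /c2; field; rewrite gt_eqF.
    move=> mA; have : delta * m%:R <= c2 * (16 * A%:R) by apply: ler_pM.
    lra.
  move=> i; exact: (level_err _ D0 c1 (ltnW G2) EA (erefl Th) GK).
exists (Num.min 16^-1 (4^-1 ^+ A)).
  by rewrite lt_min invr_gt0 ltr0n exprn_gt0// invr_gt0.
move=> n n1; rewrite ge_min; apply/orP.
(* Before time $A$ the walk may go right all the time. *)
have [nA|An] := ltnP n A; [right|left].
  apply: (@le_trans _ _ (4^-1 ^+ n)).
    by apply: ler_wiXn2l; [lra|lra|exact: ltnW].
  rewrite -[leLHS](field_cst EP n); apply: (fl_le EP) => e.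
  have := @walk_mean_right R (up_of delta e) 4^-1 0 n
    (fun x => (n%:R `^ xi <= `|x|%:~R)%R%:R) 0.
  rewrite add0r /= (_ : n%:R `^ xi <= _ = true) ?mulr1; last first.
    rewrite (_ : `|n%:Z|%:~R = n%:R) //.
    rewrite -[leRHS]powRr1 ?ler0n//; apply: ler_powR; first by rewrite ler1n.
    by rewrite /xi invf_le1 ?ltr0n// ler1n.
  apply=> // y t; rewrite /up_of.
  have dd : delta <= 4^-1 := le_trans dc2 c24.
  clear - d0 dd; case: (e y t) => [[]|] /=; apply/andP; split; lra.
(* From time $A$ on, $\mathbb E (1 - \cos \theta X_n) \ge 1/4$, while $1 - \cos
   \theta x$ is at most $1/8$ for $|x| \le n^\xi$ and at most 2 elsewhere. *)
have [|j nj] := @log_scale A n; first by rewrite A0.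
have := level _ _ nj; set th := Th / 2 ^+ j.
have p2 : 0 < 2 ^+ j :> R by rewrite exprn_gt0.
have th0 : 0 <= th by rewrite divr_ge0// ltW.
have nxi : n%:R `^ xi <= 2 * 2 ^+ j.
  apply: root_le; rewrite ?(mulr_ge0 _ (ltW p2))//.
  rewrite -natrX -natrM -natrX ler_nat expnMn -expnM.
  case/andP: nj => _ /leq_trans; apply.
  rewrite mulnA -Eq; apply: leq_mul; first exact/ltnW/ltn_expl.
  rewrite (_ : 16 = 2 ^ 4)%N// -expnM leq_exp2l// mulnC leq_mul2l.
  apply/orP; right; rewrite Eq; apply: (@leq_trans (16 * 1)); first by [].
  by rewrite leq_mul2l.
set S := (fun x : int => _); set P := walk_law _ _ _ S => R2.
have key x : (1 - 8^-1) * 1 + (- 2) * S x <= 1 * cos_at th x + 0 * 1.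
  rewrite /S mul1r mul0r addr0; case: (leP (n%:R `^ xi) `|x|%:~R) => xn /=.
    by have := cos_geN1 (th * x%:~R); rewrite /cos_at; lra.
  have := cos_at_lip 0 x th0.
  rewrite subr0 {2}/cos_at mulr0 cos0 ler_norml => /andP[h _].
  have : th * `|x|%:~R <= th * (2 * 2 ^+ j).
    by apply: ler_wpM2l => //; apply: ltW; exact: lt_le_trans nxi.
  have -> : th * (2 * 2 ^+ j) = 2 * Th.
    by rewrite /th; field; rewrite gt_eqF.
  lra.
have : (1 - 8^-1) * 1 + (- 2) * P <= walk_law E delta n (cos_at th).
  rewrite (_ : _ + _ = walk_law E delta n (fun x => (1 - 8^-1) * 1 + (- 2) * S x)).
    apply: (walk_law_le EP) => // x _; apply: le_trans (key x) _.
    by rewrite mul1r mul0r addr0.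
  by rewrite (walk_law_lin EP) (walk_law_cst EP).
set C := walk_law _ _ _ _ => PC.
have : C ^+ 2 <= 2^-1.
  by move: R2; rewrite /char_sq -/C; have := sqr_ge0 (walk_law E delta n (sin_at th)); lra.
have [Clt|Cge] := ltP C (3 / 4); first lra.
have : (3 / 4) ^+ 2 <= C ^+ 2 by rewrite lerXn2r ?nnegrE//; lra.
lra.
Qed.

(** * Stacks of independent marks *)

Section Overlay.
Context (R : realType) (I : finType).

(** What a ball shows at finitely many sites: its colour at those that it
    covers. The same type serves for what a whole configuration of balls shows. *)
Definition mark := {ffun I -> option bool}.
Definition blank : mark := [ffun=> None].
Definition overlay (s t : mark) : mark :=
  [ffun i => if s i is Some c then Some c else t i].
(** The head of the list lies on top. *)
Definition stack (l : seq mark) : mark := foldr overlay blank l.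

Implicit Types (m : mark -> R) (g : mark -> R) (s t : mark).

(** The mean of $g$ over the stack of $K$ independent marks of law $m$, a
    measure whose mass may be below 1. *)
Fixpoint stack_mean m K g : R :=
  if K is K'.+1 then \sum_t m t * stack_mean m K' (fun s => g (overlay t s))
  else g blank.

Lemma stack_meanE m K g :
  stack_mean m K g = \sum_(l : K.-tuple mark) (\prod_(t <- l) m t) * g (stack l).
Proof.
elim: K g => [|K IH] g /=.
  rewrite (big_pred1 [tuple]) => [|l]; last by apply/esym/eqP; exact: tuple0.
  by rewrite /= big_nil mul1r.
rewrite (reindex (fun p : mark * K.-tuple mark => [tuple of p.1 :: p.2])) /=; last first.
  exists (fun l => (thead l, [tuple of behead l])) => [[t l] _|l _] /=.
    by congr (_, _); apply: val_inj.
  by rewrite -tuple_eta.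
rewrite -(pair_bigA _ (fun t (l : K.-tuple mark) =>
  (\prod_(t' <- t :: l) m t') * g (stack (t :: l)))) /=.
apply: eq_bigr => t _; rewrite IH big_distrr /=; apply: eq_bigr => l _.
by rewrite big_cons mulrA.
Qed.

Lemma stack_mean_sum m K (T : finType) (a : T -> R) (g : T -> mark -> R) :
  stack_mean m K (fun s => \sum_x a x * g x s) = \sum_x a x * stack_mean m K (g x).
Proof.
elim: K g => [|K IH] g //=.
transitivity (\sum_t \sum_x m t * (a x * stack_mean m K (fun s => g x (overlay t s)))).
  by apply: eq_bigr => t _; rewrite IH big_distrr.
rewrite exchange_big /=; apply: eq_bigr => x _; rewrite big_distrr /=.
by apply: eq_bigr => t _; rewrite mulrCA.
Qed.

Lemma stack_mean_cst m K (c : R) : stack_mean m K (fun=> c) = (\sum_t m t) ^+ K * c.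
Proof.
elim: K => [|K IH] /=; first by rewrite expr0 mul1r.
by rewrite -big_distrl /= IH exprS mulrA.
Qed.

Lemma stack_mean_le m K g1 g2 : (forall t, 0 <= m t) -> (forall s, g1 s <= g2 s) ->
  stack_mean m K g1 <= stack_mean m K g2.
Proof.
move=> m0; elim: K g1 g2 => [|K IH] g1 g2 H /=; first exact: H.
by apply: ler_sum => t _; apply: ler_wpM2l => //; apply: IH.
Qed.

Lemma stack_mean_norm m K g (B : R) : (forall t, 0 <= m t) -> \sum_t m t <= 1 ->
  (forall s, `|g s| <= B) -> `|stack_mean m K g| <= B.
Proof.
move=> m0 m1 gB; have B0 : 0 <= B := le_trans (normr_ge0 _) (gB blank).
have S0 : 0 <= \sum_t m t by apply: sumr_ge0.
have SK : (\sum_t m t) ^+ K <= 1 by exact: exprn_ile1.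
have S1 : (\sum_t m t) ^+ K * B <= B by rewrite ler_piMl.
rewrite ler_norml; apply/andP; split.
  apply: (@le_trans _ _ (stack_mean m K (fun=> - B))).
    by rewrite stack_mean_cst mulrN lerN2.
  by apply: stack_mean_le => // s; have := gB s; rewrite ler_norml => /andP[].
apply: (@le_trans _ _ (stack_mean m K (fun=> B))); last by rewrite stack_mean_cst.
by apply: stack_mean_le => // s; have := gB s; rewrite ler_norml => /andP[].
Qed.

Lemma stack_mean_near m m' K g (B : R) : (forall t, 0 <= m t) -> \sum_t m t <= 1 ->
  (forall t, 0 <= m' t) -> \sum_t m' t <= 1 -> (forall s, `|g s| <= B) ->
  `|stack_mean m K g - stack_mean m' K g| <= K%:R * (B * \sum_t `|m t - m' t|).
Proof.
move=> m0 m1 m0' m1'; elim: K g => [|K IH] g gB /=.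
  by rewrite subrr normr0 mul0r.
set S := \sum_t `|_|.
rewrite -sumrB; apply: le_trans (ler_norm_sum _ _ _) _.
have S0 : 0 <= S by apply: sumr_ge0.
have B0 : 0 <= B := le_trans (normr_ge0 _) (gB blank).
apply: (@le_trans _ _ (\sum_t (B * `|m t - m' t| + m' t * (K%:R * (B * S))))).
  apply: ler_sum => t _; set f := fun s => _.
  rewrite (_ : _ - _ = (m t - m' t) * stack_mean m K f +
    m' t * (stack_mean m K f - stack_mean m' K f)); last by ring.
  apply: le_trans (ler_normD _ _) _; rewrite !normrM; apply: lerD.
    by rewrite mulrC ler_wpM2r//; apply: stack_mean_norm => // s; exact: gB.
  by rewrite (ger0_norm (m0' t)) ler_wpM2l//; apply: IH => s; exact: gB.
rewrite big_split /= -big_distrr -big_distrl /= -/S -natr1 mulrDl mul1r addrC.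
by rewrite lerD2r ler_piMl// !mulr_ge0.
Qed.

Section Mixing.
Context (F1 F2 : pred I).

Definition hits (F : pred I) (t : mark) := [exists i, F i && (t i != None)].

Definition local2 (Phi : mark -> mark -> R) :=
  forall s s' t t', {in F1, s =1 s'} -> {in F2, t =1 t'} -> Phi s t = Phi s' t'.

Lemma hitsPn F t : ~~ hits F t -> {in F, t =1 blank}.
Proof.
move=> /existsPn H i iF; rewrite ffunE.
by have := H i; rewrite -[F i]/(i \in F) iF /= negbK => /eqP.
Qed.

Context (m : mark -> R) (m0 : forall t, 0 <= m t) (m1 : \sum_t m t = 1).

(** The two ways for marks to break the splitting in [mark_decouple]: one mark
    that hits both regions, or two marks that hit one region each. *)
Definition mix_rate : R :=
  \sum_(t | hits F1 t && hits F2 t) m t +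
  (\sum_(t | hits F1 t) m t) * (\sum_(t | hits F2 t) m t).

(** Unless one of these rare marks occurs, $\Psi(t, t')$ is a function of $t$
    plus a function of $t'$, and the mean of such a sum does not depend on
    whether $t$ and $t'$ are equal or independent. *)
Lemma mark_decouple Psi (B : R) : local2 Psi -> (forall s t, `|Psi s t| <= B) ->
  `|\sum_t m t * Psi t t - \sum_t m t * (\sum_t' m t' * Psi t t')| <=
  4 * B * mix_rate.
Proof.
move=> loc PB; pose D t t' := Psi t t' - Psi t blank - Psi blank t' + Psi blank blank.
have DB t t' : `|D t t'| <= 4 * B.
  rewrite /D; have := PB t t'; have := PB t blank; have := PB blank t'.
  have := PB blank blank; rewrite !ler_norml.
  by move=> /andP[? ?] /andP[? ?] /andP[? ?] /andP[? ?]; apply/andP; split; lra.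
have D1 t t' : ~~ hits F1 t -> D t t' = 0.
  move=> /hitsPn h; rewrite /D (loc t blank t' t')// (loc t blank blank blank)//.
  ring.
have D2 t t' : ~~ hits F2 t' -> D t t' = 0.
  move=> /hitsPn h; rewrite /D (loc t t t' blank)// (loc blank blank t' blank)//.
  ring.
have -> : \sum_t m t * Psi t t - \sum_t m t * (\sum_t' m t' * Psi t t') =
    \sum_t m t * D t t - \sum_t m t * (\sum_t' m t' * D t t').
  (* In the difference the terms that depend on one mark only cancel, because
     $m$ has mass 1. *)
  pose al t := Psi t blank; pose be t := Psi blank t; pose p0 := Psi blank blank.
  have e1 : \sum_t m t * D t t = \sum_t m t * Psi t t - \sum_t m t * al t -
      \sum_t m t * be t + p0.
    rewrite -[p0]mul1r -m1 big_distrl /= -!sumrB -big_split /=.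
    by apply: eq_bigr => t _; rewrite /D /al /be /p0; ring.
  have e2 t : \sum_t' m t' * D t t' = \sum_t' m t' * Psi t t' - al t -
      \sum_t' m t' * be t' + p0.
    rewrite -[p0]mul1r -[al t]mul1r -m1 !big_distrl /= -!sumrB -big_split /=.
    by apply: eq_bigr => t' _; rewrite /D /al /be /p0; ring.
  have e3 : \sum_t m t * (\sum_t' m t' * D t t') =
      \sum_t m t * (\sum_t' m t' * Psi t t') - \sum_t m t * al t -
      \sum_t' m t' * be t' + p0.
    rewrite -[p0]mul1r -[X in _ - _ - X + _]mul1r -m1.
    rewrite [X in _ - _ - X + _]big_distrl /= [X in _ - _ - _ + X]big_distrl /=.
    rewrite -!sumrB -big_split /=; apply: eq_bigr => t _.
    by rewrite e2; ring.
  by rewrite e1 e3; ring.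
apply: le_trans (ler_normB _ _) _; rewrite /mix_rate mulrDr; apply: lerD.
  rewrite (bigID (fun t => hits F1 t && hits F2 t)) /= [X in _ + X]big1 ?addr0.
    rewrite big_distrr /=; apply: le_trans (ler_norm_sum _ _ _) _.
    apply: ler_sum => t _; rewrite normrM (ger0_norm (m0 t)) mulrC.
    by rewrite ler_wpM2r.
  by move=> t; rewrite negb_and => /orP[/D1|/D2] ->; rewrite mulr0.
rewrite (bigID (hits F1)) /= [X in _ + X]big1 ?addr0; last first.
  by move=> t h; rewrite big1 ?mulr0// => t' _; rewrite D1// mulr0.
rewrite mulrCA big_distrl /=; apply: le_trans (ler_norm_sum _ _ _) _.
apply: ler_sum => t _; rewrite normrM (ger0_norm (m0 t)); apply: ler_wpM2l => //.
rewrite (bigID (hits F2)) /= [X in _ + X]big1 ?addr0; last first.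
  by move=> t' h; rewrite D2// mulr0.
rewrite big_distrr /=; apply: le_trans (ler_norm_sum _ _ _) _.
apply: ler_sum => t' _; rewrite normrM (ger0_norm (m0 t')) mulrC.
by rewrite ler_wpM2r.
Qed.

(** The marks of one level after the other are replaced by pairs of independent
    marks, at the cost of [mark_decouple] each time. *)
Lemma stack_mean_decouple K Phi (B : R) : local2 Phi -> (forall s t, `|Phi s t| <= B) ->
  `|stack_mean m K (fun s => Phi s s) -
    stack_mean m K (fun s => stack_mean m K (Phi s))| <= K%:R * (4 * B * mix_rate).
Proof.
elim: K Phi => [|K IH] Phi loc PB /=; first by rewrite subrr normr0 mul0r.
have locO t t' : local2 (fun s s' => Phi (overlay t s) (overlay t' s')).
  by move=> a a' b b' ha hb; apply: loc => i iF; rewrite !ffunE ?ha ?hb.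
pose Psi t t' := stack_mean m K (fun s =>
  stack_mean m K (fun s' => Phi (overlay t s) (overlay t' s'))).
have -> : \sum_t m t * stack_mean m K (fun s => \sum_t' m t' *
    stack_mean m K (fun s' => Phi (overlay t s) (overlay t' s'))) =
    \sum_t m t * (\sum_t' m t' * Psi t t').
  by apply: eq_bigr => t _; rewrite stack_mean_sum.
have e1 : `|\sum_t m t * stack_mean m K (fun s => Phi (overlay t s) (overlay t s)) -
    \sum_t m t * Psi t t| <= K%:R * (4 * B * mix_rate).
  rewrite -sumrB; apply: le_trans (ler_norm_sum _ _ _) _.
  set Q := (X in _ <= X).
  rewrite (_ : Q = \sum_t m t * Q); last by rewrite -big_distrl /= m1 mul1r.
  apply: ler_sum => t _.
  rewrite -mulrBr normrM (ger0_norm (m0 t)); apply: ler_wpM2l => //.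
  exact: (IH _ (locO t t) (fun s s' => PB _ _)).
have m1' : \sum_t m t <= 1 by rewrite m1.
have e2 : `|\sum_t m t * Psi t t - \sum_t m t * (\sum_t' m t' * Psi t t')| <=
    4 * B * mix_rate.
  apply: mark_decouple.
    move=> s s' t t' hs ht; rewrite /Psi; congr (stack_mean m K _).
    apply/funext => a; congr (stack_mean m K _); apply/funext => b.
    by apply: loc => i iF; rewrite !ffunE ?hs ?ht.
  by move=> s t; do 2![apply: stack_mean_norm => // ?].
rewrite -natr1 mulrDl mul1r; apply: le_trans (lerD e1 e2).
by apply: le_trans (ler_normD _ _); rewrite addrA subrK.
Qed.

End Mixing.

Section Poissonian.
Context (La : mark -> R) (La0 : forall t, 0 <= La t).

Definition total_rate : R := \sum_(t | t != blank) La t.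

Lemma total_rate_ge0 : 0 <= total_rate.
Proof. exact: sumr_ge0. Qed.

(** The law of the mark of one of $K$ equal weight levels, restricted to the
    event that the level holds at most one ball that covers a site: the numbers
    of balls with given marks are independent Poisson variables. *)
Definition level_mass (K : nat) (t : mark) : R :=
  expR (- (total_rate / K%:R)) * (if t == blank then 1 else La t / K%:R).

(** The probability measure that agrees with [level_mass] to first order in
    $1/K$. *)
Definition level_law (K : nat) (t : mark) : R :=
  if t == blank then 1 - total_rate / K%:R else La t / K%:R.

Context (K : nat) (K0 : (0 < K)%N) (MK : total_rate <= K%:R).
Local Notation x := (total_rate / K%:R).

Let x0 : 0 <= x. Proof. by rewrite divr_ge0// total_rate_ge0. Qed.
Let x1 : x <= 1. Proof. by rewrite ler_pdivrMr ?ltr0n// mul1r. Qed.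

Let sumE (a : R) (f : mark -> R) :
  \sum_t (if t == blank then a else f t) = a + \sum_(t | t != blank) f t.
Proof.
rewrite (bigD1 blank) //= eqxx; congr (_ + _).
by apply: eq_bigr => t /negbTE ->.
Qed.

Let sumLa : \sum_(t | t != blank) La t / K%:R = x.
Proof. by rewrite -big_distrl. Qed.

Let expx_lo : 1 - x <= expR (- x). Proof. exact: expR_ge1Dx. Qed.
Let expx_hi : expR (- x) * (1 + x) <= 1.
Proof. by rewrite expRN mulrC ler_pdivrMr ?expR_gt0// mul1r expR_ge1Dx. Qed.

Lemma level_law_ge0 t : 0 <= level_law K t.
Proof. by rewrite /level_law; case: ifP => _; rewrite ?subr_ge0// divr_ge0. Qed.

Lemma level_law_sum : \sum_t level_law K t = 1.
Proof. by rewrite sumE sumLa subrK. Qed.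

Lemma level_mass_ge0 t : 0 <= level_mass K t.
Proof.
by rewrite /level_mass mulr_ge0 ?expR_ge0//; case: ifP => _ //; rewrite divr_ge0.
Qed.

Lemma level_mass_sum : \sum_t level_mass K t = expR (- x) * (1 + x).
Proof. by rewrite -big_distrr /= sumE sumLa. Qed.

(** The mass that one level lacks is of order $1/K^2$, because two balls in one
    level are that rare. *)
Lemma level_mass_lack : 1 - (\sum_t level_mass K t) ^+ K <= total_rate ^+ 2 / K%:R.
Proof.
have y0 : 0 <= 1 - x ^+ 2 by rewrite subr_ge0 exprn_ile1.
have h : 1 - x ^+ 2 <= \sum_t level_mass K t.
  rewrite level_mass_sum (_ : 1 - x ^+ 2 = (1 - x) * (1 + x)); last by ring.
  by apply: ler_wpM2r; rewrite ?addr_ge0.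
have bern n : 1 - n%:R * x ^+ 2 <= (1 - x ^+ 2) ^+ n.
  elim: n => [|n IH]; first by rewrite mul0r subr0 expr0.
  rewrite [leRHS]exprS; apply: (@le_trans _ _ ((1 - x ^+ 2) * (1 - n%:R * x ^+ 2))).
    have : 0 <= n%:R * x ^+ 2 * x ^+ 2 by rewrite -mulrA -exprD mulr_ge0// exprn_ge0.
    by rewrite -natr1; lra.
  by apply: ler_wpM2l.
have e : K%:R * x ^+ 2 = total_rate ^+ 2 / K%:R.
  by field; rewrite pnatr_eq0 -lt0n.
rewrite -e; have := bern K.
have : (1 - x ^+ 2) ^+ K <= (\sum_t level_mass K t) ^+ K.
  by rewrite lerXn2r ?nnegrE//; exact: le_trans h.
lra.
Qed.

Lemma level_mass_near :
  \sum_t `|level_mass K t - level_law K t| <= 2 * x ^+ 2.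
Proof.
pose a := `|expR (- x) - (1 - x)|.
pose f t := `|expR (- x) * (La t / K%:R) - La t / K%:R|.
rewrite (eq_bigr (fun t => if t == blank then a else f t)); last first.
  by move=> t _; rewrite /level_mass /level_law; case: ifP => _; rewrite ?mulr1.
have ex : expR (- x) <= 1 - x + x ^+ 2.
  have : expR (- x) * (1 + x) <= (1 - x + x ^+ 2) * (1 + x).
    apply: le_trans expx_hi _.
    rewrite (_ : (1 - x + x ^+ 2) * (1 + x) = 1 + x ^+ 3); last by ring.
    by rewrite lerDl exprn_ge0.
  by rewrite ler_pM2r//; apply: ltr_wpDr.
rewrite sumE (_ : 2 * _ = x ^+ 2 + x ^+ 2); last by ring.
apply: lerD; first by have lo := expx_lo; rewrite /a ger0_norm; lra.
apply: (@le_trans _ _ (\sum_(t | t != blank) x * (La t / K%:R))).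
  apply: ler_sum => t _; rewrite /f -{2}[La t / _]mul1r -mulrBl normrM.
  rewrite [X in _ * X]ger0_norm ?divr_ge0//; apply: ler_wpM2r; first by rewrite divr_ge0.
  have lo := expx_lo; have hi : expR (- x) <= 1 by rewrite expR_le1 oppr_le0.
  by rewrite ler0_norm; lra.

by rewrite -big_distrr /= sumLa expr2.
Qed.

(** A law that charges each stack at least as much as independent levels do is
    close to the law of the stack, because these charges add up to almost 1. *)
Lemma stack_law_near (L : mark -> R) g (B : R) :
  \sum_s L s = 1 ->
  (forall s, \sum_(l : K.-tuple mark | stack l == s)
     (\prod_(t <- l) level_mass K t) <= L s) ->
  (forall s, `|g s| <= B) ->
  `|\sum_s L s * g s - stack_mean (level_law K) K g| <= B * (3 * total_rate ^+ 2) / K%:R.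
Proof.
move=> L1 Lge gB; pose l s := \sum_(l : K.-tuple mark | stack l == s)
     (\prod_(t <- l) level_mass K t).
have B0 : 0 <= B := le_trans (normr_ge0 _) (gB blank).
have e1 h : stack_mean (level_mass K) K h = \sum_s l s * h s.
  rewrite stack_meanE (partition_big (fun t : K.-tuple mark => stack t) xpredT) //=.
  apply: eq_bigr => s _; rewrite big_distrl /=.
  by apply: eq_bigr => t /eqP ->.
have d1 : `|\sum_s L s * g s - stack_mean (level_mass K) K g| <=
    B * (total_rate ^+ 2 / K%:R).
  rewrite e1 -sumrB; apply: le_trans (ler_norm_sum _ _ _) _.
  apply: (@le_trans _ _ (\sum_s B * (L s - l s))).
    apply: ler_sum => s _; rewrite -mulrBl normrM mulrC.
    by rewrite (ger0_norm (_ : 0 <= L s - l s)) ?subr_ge0 ?Lge// ler_wpM2r ?subr_ge0 ?Lge.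
  rewrite -big_distrr /= sumrB L1; apply: ler_wpM2l => //.
  have <- : (\sum_t level_mass K t) ^+ K = \sum_s l s; last exact: level_mass_lack.
  rewrite -[LHS]mulr1 -stack_mean_cst e1.
  by apply: eq_bigr => s _; rewrite mulr1.
have d2 : `|stack_mean (level_mass K) K g - stack_mean (level_law K) K g| <=
    K%:R * (B * (2 * x ^+ 2)).
  apply: (@le_trans _ _ (K%:R * (B * \sum_t `|level_mass K t - level_law K t|))).
    apply: stack_mean_near => //.
    - exact: level_mass_ge0.
    - by rewrite level_mass_sum.
    - exact: level_law_ge0.
    - by rewrite level_law_sum.
  by apply: ler_wpM2l => //; apply: ler_wpM2l => //; exact: level_mass_near.
have e : K%:R * (B * (2 * x ^+ 2)) = B * (2 * total_rate ^+ 2) / K%:R.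
  by field; rewrite pnatr_eq0 -lt0n.
rewrite e in d2.
have -> : B * (3 * total_rate ^+ 2) / K%:R =
   B * (total_rate ^+ 2 / K%:R) + B * (2 * total_rate ^+ 2) / K%:R by ring.
apply: le_trans (lerD d1 d2).
by apply: le_trans (ler_normD _ _); rewrite addrA subrK.
Qed.

End Poissonian.

End Overlay.

(** * Translation invariance of the ball intensity *)

Section Preservation.
Context (R : realType).

Definition preserves d (T : measurableType d) (m : set T -> \bar R) (phi : T -> T) :=
  measurable_fun setT phi /\ forall A, measurable A -> m (phi @^-1` A) = m A.

(** The push-forward as a bundled measure, in the form that uniqueness theorems
    for measures take. *)
Lemma image_measure d1 d2 (T1 : measurableType d1) (T2 : measurableType d2)
    (m : {measure set T1 -> \bar R}) (f : T1 -> T2) : measurable_fun setT f ->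
  exists M : {measure set T2 -> \bar R}, forall A, M A = m (f @^-1` A).
Proof.
move=> mf; unshelve eexists.
  refine (Measure.clone _ _ _ (pushforward m f) _).
  exact: mf.
by [].
Qed.

(** The push-forward and the product measure agree on rectangles. *)
Lemma preserves_prod d1 d2 (T1 : measurableType d1) (T2 : measurableType d2)
    (m1 : {sigma_finite_measure set T1 -> \bar R})
    (m2 : {sigma_finite_measure set T2 -> \bar R}) phi1 phi2 :
  preserves m1 phi1 -> preserves m2 phi2 ->
  preserves (m1 \x m2)%E (fun p => (phi1 p.1, phi2 p.2)).
Proof.
move=> [mf1 p1] [mf2 p2]; set phi := fun p => _.
have mphi : measurable_fun setT phi.
  by apply: measurable_fun_pair; apply: measurableT_comp.
split=> // A mA.
have [M ME] := image_measure (m1 \x m2)%E mphi.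
rewrite [RHS](product_measure_unique (m' := M))// => B C mB mC; rewrite ME /=.
rewrite (_ : phi @^-1` (B `*` C) = (phi1 @^-1` B) `*` (phi2 @^-1` C)); last first.
  by apply/seteqP; split => -[x y].
have mfB : measurable (phi1 @^-1` B) by rewrite -[phi1 @^-1` B]setTI; exact: mf1.
have mfC : measurable (phi2 @^-1` C) by rewrite -[phi2 @^-1` C]setTI; exact: mf2.
by rewrite product_measure1E//; congr (_ * _)%E; [exact: p1|exact: p2].
Qed.

(** A change of variables in the outer integral of the product measure; by
    repetition, moving the centres alone preserves the intensity of the balls. *)
Lemma preserves_prod_l d1 d2 (T1 : measurableType d1) (T2 : measurableType d2)
    (m1 : {measure set T1 -> \bar R})
    (m2 : {sigma_finite_measure set T2 -> \bar R}) phi1 :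
  preserves m1 phi1 -> preserves (m1 \x m2)%E (fun p => (phi1 p.1, p.2)).
Proof.
move=> [mf1 p1]; split=> [|A mA].
  apply: measurable_fun_pair; last exact: measurable_snd.
  by apply: measurableT_comp.
rewrite /product_measure1.
transitivity (\int[m1]_x (((m2 \o xsection A) \o phi1) x))%E.
  by apply: eq_integral => x _ /=; congr (m2 _).
have mA' := measurable_fun_xsection m2 mA.
rewrite -(preimage_setT phi1) -ge0_integral_pushforward//.
by apply: eq_measure_integral => B mB _; exact: p1.
Qed.

Lemma preserves_translation (a : R) :
  preserves (@lebesgue_measure R) (fun x : measurableTypeR R => x + a).
Proof.
have ma : measurable_fun setT (fun x : measurableTypeR R => x + a).
  by apply: measurable_funD.
split=> // A mA.
have [M ME] := @image_measure _ _ (measurableTypeR R) (measurableTypeR R)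
  (@lebesgue_measure R) _ ma.
rewrite [RHS](@lebesgue_measure_unique _ M)// => _ [[x y] _ <-]; rewrite ME /=.
rewrite (_ : _ @^-1` _ = `](x - a), (y - a)]%classic); last first.
  by apply/seteqP; split => z /=; rewrite !in_itv/= ltrBlDr lerBrDr.
rewrite !lebesgue_measure_itv/= !lte_fin ltrD2r; case: ifP => // _.
by rewrite -!EFinB; congr EFin; ring.
Qed.

Definition translate (v : R * R) (b : ball_type R) : ball_type R :=
  ((((b.1.1.1.1 + v.1, b.1.1.1.2 + v.2), b.1.1.2), b.1.2), b.2).

Lemma preserves_translate (nu : probability (measurableTypeR R) R) v :
  preserves (confetti_intensity nu) (translate v).
Proof.

have h1 := preserves_prod (preserves_translation v.1) (preserves_translation v.2).
have h2 := preserves_prod_l nu h1.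
have h3 := preserves_prod_l (@color_measure R) h2.
exact: (preserves_prod_l (uniform_prob (@ltr01 R)) h3).
Qed.

Lemma intensity_weight (nu : probability (measurableTypeR R) R)
    (A : set (measurableTypeR R * measurableTypeR R * measurableTypeR R * measurableTypeR R))
    (W : set (measurableTypeR R)) : measurable A -> measurable W ->
  confetti_intensity nu (A `*` W) =
  (confetti_intensity nu (A `*` setT) * uniform_prob (@ltr01 R) W)%E.
Proof.
move=> mA mW; rewrite /confetti_intensity /= !product_measure1E//.
set Q := (X in (_ * X * _)%E); have -> : Q = 1%E by exact: probability_setT.
by rewrite mule1.
Qed.

Lemma product_full d1 d2 (T1 : measurableType d1) (T2 : measurableType d2)
    (m1 : {measure set T1 -> \bar R}) (m2 : probability T2 R) (A : set T1) :
  measurable A -> (m1 \x m2)%E (A `*` setT) = m1 A.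
Proof.
by move=> mA; rewrite product_measure1E//; set Q := (X in (_ * X)%E);
  have -> : Q = 1%E by [exact: probability_setT]; rewrite mule1.
Qed.

Lemma intensity_box (nu : probability (measurableTypeR R) R)
    (A1 A2 A3 : set (measurableTypeR R)) :
  measurable A1 -> measurable A2 -> measurable A3 ->
  confetti_intensity nu (A1 `*` A2 `*` A3 `*` setT `*` setT) =
  (lebesgue_measure A1 * lebesgue_measure A2 * nu A3)%E.
Proof.
move=> m1 m2 m3.
have m12 : measurable (A1 `*` A2) by exact: measurableX.
have m123 : measurable (A1 `*` A2 `*` A3) by exact: measurableX.
have m1234 : measurable (A1 `*` A2 `*` A3 `*` (setT : set (measurableTypeR R))).
  exact: measurableX.
refine (etrans (product_full _ (uniform_prob (@ltr01 R)) m1234) _).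
refine (etrans (product_full _ (@color_measure R) m123) _).
refine (etrans (product_measure1E _ nu m12 m3) _); congr (_ * _)%E.
exact: product_measure1E.
Qed.

End Preservation.

(** * Rates of covering patterns *)

Local Notation center := Defs.center.
Local Notation radius := Defs.radius.

Section Covering.
Context (R : realType).
Implicit Types (b : ball_type R) (w v : R * R).

Lemma coversE b w : covers b w <->
  0 <= radius b /\ (w.1 - (center b).1) ^+ 2 + (w.2 - (center b).2) ^+ 2 <= radius b ^+ 2.
Proof.
rewrite /covers /dist2; set a := _ + _.
have a0 : 0 <= a by rewrite addr_ge0// sqr_ge0.
split=> [h|[r0 h]].
  have r0 : 0 <= radius b by apply: le_trans h; exact: sqrtr_ge0.
  by split=> //; rewrite -(sqr_sqrtr a0) lerXn2r ?nnegrE ?sqrtr_ge0.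
by rewrite -(ger0_norm r0) -sqrtr_sqr ler_sqrt// sqr_ge0.
Qed.

Lemma covers_coord b w : covers b w ->
  `|w.1 - (center b).1| <= radius b /\ `|w.2 - (center b).2| <= radius b.
Proof.
move=> /coversE[r0 h].
have sq (x y : R) : x ^+ 2 + y ^+ 2 <= radius b ^+ 2 -> `|x| <= radius b.
  move=> xy; rewrite -(@ler_pXn2r _ 2) ?nnegrE// real_normK ?num_real//.
  by apply: le_trans xy; rewrite lerDl sqr_ge0.
by split; [exact: sq h|apply: (sq _ (w.1 - (center b).1)); rewrite addrC].
Qed.

Let mradius : measurable_fun setT (@radius R).
Proof.
rewrite /radius; apply: measurableT_comp; first exact: measurable_snd.
by apply: measurableT_comp; [exact: measurable_fst|exact: measurable_fst].
Qed.

Let mcolor : measurable_fun setT (@color R).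
Proof.
by rewrite /color; apply: measurableT_comp;
  [exact: measurable_snd|exact: measurable_fst].
Qed.

Let mcenter1 : measurable_fun setT (fun b => (center b).1).
Proof.
have m3 : measurable_fun setT (@center R).
  rewrite /center; do 2 (apply: measurableT_comp; first exact: measurable_fst).
  exact: measurable_fst.
exact: (measurableT_comp measurable_fst m3).
Qed.

Let mcenter2 : measurable_fun setT (fun b => (center b).2).
Proof.
have m3 : measurable_fun setT (@center R).
  rewrite /center; do 2 (apply: measurableT_comp; first exact: measurable_fst).
  exact: measurable_fst.
exact: (measurableT_comp measurable_snd m3).
Qed.

Lemma measurable_ge_radius (r : R) : measurable [set b | r <= radius b].
Proof.
rewrite -[X in measurable X]setTI; exact: measurable_fun_le.
Qed.

Lemma measurable_covers w : measurable [set b | covers b w].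
Proof.
rewrite (_ : [set b | _] = [set b | 0 <= radius b] `&`
    [set b | (w.1 - (center b).1) ^+ 2 + (w.2 - (center b).2) ^+ 2 <= radius b ^+ 2]).
  apply: measurableI; first exact: measurable_ge_radius.
  rewrite -[X in measurable X]setTI; apply: measurable_fun_le => //.
    apply: measurable_funD; apply: measurable_funX;
      apply: measurable_funB => //; exact: measurable_cst.
  exact: measurable_funX.
by apply/seteqP; split=> b /=; rewrite coversE.
Qed.

Lemma measurable_pos_color : measurable [set b : ball_type R | 0 < color b].
Proof.
rewrite (_ : [set b | _] = ~` [set b : ball_type R | color b <= 0]); last first.
  by apply/seteqP; split=> b /=; rewrite ltNge => /negP.
apply: measurableC; rewrite -[X in measurable X]setTI; exact: measurable_fun_le.
Qed.

Section Marks.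
Context (I : finType).
Implicit Types z : I -> R * R.

Definition mark_of z b : mark I :=
  [ffun i => if `[< covers b (z i) >] then Some (0 < color b) else None].

Lemma measurable_mark z t : measurable [set b | mark_of z b = t].
Proof.
rewrite (_ : [set b | _] = \bigcap_(i in [set: I]) [set b | mark_of z b i = t i]).
  apply: fin_bigcap_measurable; first exact: finite_finset.
  move=> i _.
  have mc := measurable_covers (z i); have mp := measurable_pos_color.
  case E : (t i) => [[]|].
  - rewrite (_ : [set b | _] = [set b | covers b (z i)] `&` [set b | 0 < color b]).
      exact: measurableI.
    apply/seteqP; split=> b /=; rewrite ffunE; case: asboolP => // h.
    + by case=> ->.
    + by case=> _ ->.
    + by case.
  - rewrite (_ : [set b | _] = [set b : ball_type R | covers b (z i)] `\`
        [set b : ball_type R | 0 < color b]).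
      exact: measurableD.
    apply/seteqP; split=> b /=; rewrite ffunE; case: asboolP => // h.
    + by case=> e; split=> //; rewrite e.
    + by case=> _ /negP/negbTE ->.
    + by case.
  - rewrite (_ : [set b | _] = ~` [set b | covers b (z i)]).
      exact: measurableC.
    by apply/seteqP; split=> b /=; rewrite ffunE; case: asboolP.
apply/seteqP; split=> b /= h; first by move=> i _ /=; rewrite h.
by apply/ffunP => i; exact: h.
Qed.

Lemma mark_of_translate z v b :
  mark_of (fun i => (z i + v)) (translate v b) = mark_of z b.
Proof.
apply/ffunP => i; rewrite !ffunE.
rewrite (_ : `[< _ >] = `[< covers b (z i) >])//; congr asbool.
rewrite /covers /dist2 /=; congr (Num.sqrt _ <= _).
by congr (_ ^+ 2 + _ ^+ 2); ring.
Qed.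

End Marks.

End Covering.

Section FiniteFamilies.
Context d (T : measurableType d) (R : realType) (m : {measure set T -> \bar R}).
Context (J : finType) (F : J -> set T).

Lemma sum_measure_fin (Q : pred J) : trivIset [set j | Q j] F ->
  (forall j, Q j -> measurable (F j)) ->
  (\sum_(j | Q j) m (F j) = m (\bigcup_(j in [set j | Q j]) F j))%E.
Proof.
move=> tF mF; rewrite measure_fin_bigcup//; last exact: finite_finset.
apply: bigfs; first exact: index_enum_uniq.
by move=> j _; rewrite mem_index_enum.
Qed.

Lemma measure_bigcup_le : (forall j, measurable (F j)) ->
  (m (\bigcup_(j in [set: J]) F j) <= \sum_j m (F j))%E.
Proof.
move=> mF; have mU : measurable (\bigcup_(j in [set: J]) F j).
  by apply: fin_bigcup_measurable => // j _; exact: mF.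
have := content_sub_fsum m (finite_finset : finite_set [set: J]) (fun j _ => mF j)
  mU (fun x h => h).
move=> /le_trans; apply.
rewrite le_eqVlt; apply/orP; left; apply/eqP/esym.
rewrite (_ : [set: J] = [set` (@predT J)]); last by apply/seteqP; split.
apply: bigfs; first exact: index_enum_uniq.
by move=> j _; rewrite mem_index_enum.
Qed.

End FiniteFamilies.

Section Rates.
Context (R : realType) (nu : probability (measurableTypeR R) R).
Context (c alpha : R) (c0 : 0 < c) (alpha20 : 20 <= alpha).
Context (nu_tail : forall r : R, 0 < r ->
  (nu `[r, +oo[%classic <= (c * r `^ (- alpha))%:E)%E).
Local Notation mu := (confetti_intensity nu).
Implicit Types (b : ball_type R) (w v : R * R).

(** A product set, so that its intensity is explicit, that holds the balls that
    cover $w$ and have radius in $[k, k + 1)$. *)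
Definition shell w (k : nat) : set (ball_type R) :=
  `[w.1 - k.+1%:R, w.1 + k.+1%:R] `*` `[w.2 - k.+1%:R, w.2 + k.+1%:R] `*`
  `[k%:R, +oo[ `*` setT `*` setT.

Lemma measurable_shell w k : measurable (shell w k).
Proof. by do 4 (apply: measurableX => //). Qed.

Lemma intensity_shell w k :
  mu (shell w k) = (((2 * k.+1%:R) ^+ 2)%:E * nu `[k%:R, +oo[%classic)%E.
Proof.
rewrite intensity_box// !lebesgue_measure_itv/= !lte_fin.
have h (a : R) : a - k.+1%:R < a + k.+1%:R.
  by rewrite ltrBlDr -addrA ltrDl -natrD ltr0n.
rewrite !h -!EFinB -EFinM; congr (_%:E * _)%E; ring.
Qed.

Lemma covers_in_shell b w : covers b w -> shell w (Num.trunc (radius b)) b.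
Proof.
move=> /[dup] /coversE[r0 _] /covers_coord[h1 h2].
have /andP[t1 t2] := Num.Theory.truncn_itv r0.
move: h1 h2; rewrite !ler_norml => /andP[a1 a2] /andP[b1 b2].
rewrite /shell /=; do !split => //; rewrite /= in_itv/= ?andbT//.
- by apply/andP; split; rewrite /center /= in a1 a2 *; lra.
- by apply/andP; split; rewrite /center /= in b1 b2 *; lra.
Qed.

Lemma intensity_shell_le w k : (0 < k)%N ->
  (mu (shell w k) <= (16 * c / k%:R ^+ 18)%:E)%E.
Proof.
move=> k0; have kR : 1 <= k%:R :> R by rewrite ler1n.
have kp : 0 < k%:R :> R by rewrite ltr0n.
rewrite intensity_shell; apply: (@le_trans _ _
  (((2 * k.+1%:R) ^+ 2)%:E * (c * k%:R `^ (- alpha))%:E)%E).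
  by apply: lee_wpmul2l; rewrite ?lee_fin ?sqr_ge0//; exact: nu_tail.
rewrite -EFinM lee_fin.
have h1 : k%:R `^ (- alpha) <= (k%:R ^+ 20)^-1 :> R.
  rewrite -powR_mulrn// -powRN; apply: ler_powR => //; by rewrite lerN2.
have h2 : (2 * k.+1%:R) ^+ 2 <= (4 * k%:R) ^+ 2 :> R.
  by rewrite lerXn2r ?nnegrE ?mulr_ge0// -[k.+1%:R]natr1; lra.
apply: (@le_trans _ _ ((4 * k%:R) ^+ 2 * (c * (k%:R ^+ 20)^-1))).
  apply: ler_pM => //; rewrite ?sqr_ge0 ?mulr_ge0 ?powR_ge0 ?(ltW c0)//.
  by rewrite ler_pM2l.
rewrite [leLHS](_ : _ = 16 * c / k%:R ^+ 18)//.
by field; rewrite gt_eqF.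
Qed.

Lemma sum_inv_sq (N n : nat) : (0 < N)%N ->
  \sum_(N <= k < n) (k%:R ^+ 2)^-1 <= 2 :> R.
Proof.
move=> N0; have [nN|Nn] := leqP n N; first by rewrite big_geq.
(* Each term is at most $2/(k(k+1))$, and these telescope. *)
have H : \sum_(N <= k < n) (k%:R ^+ 2)^-1 <=
    \sum_(N <= k < n) (- 2 / k.+1%:R - - 2 / k%:R) :> R.
  rewrite big_nat_cond [leRHS]big_nat_cond; apply: ler_sum => k /andP[/andP[Nk _] _].
  have kp : 1 <= k%:R :> R by rewrite ler1n; lia.
  have k0 : 0 < k%:R :> R by lra.
  have k1 : 0 < k.+1%:R :> R by rewrite ltr0n.
  have -> : - 2 / k.+1%:R - - 2 / k%:R = 2 / (k%:R * k.+1%:R) :> R.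
    rewrite -[k.+1%:R]natr1; field; rewrite gt_eqF//= gt_eqF//; lra.
  rewrite -[leLHS]mul1r ler_pdivlMr ?mulr_gt0// mul1r mulrC ler_pdivrMr ?exprn_gt0//.
  rewrite -[k.+1%:R]natr1 expr2; have := @ler_wpM2l _ k%:R (ltW k0) _ _ kp; lra.
apply: le_trans H _; rewrite telescope_sumr; last exact: ltnW.
have : 0 <= 2 / n%:R :> R by rewrite divr_ge0.
have : 2 / N%:R <= 2 :> R by rewrite ler_pdivrMr ?ltr0n// ler_peMr// ler1n.
rewrite !mulNr; lra.
Qed.

(** Summing the intensities of the shells with $k \ge N$, which are of order
    $k^2 k^{-\alpha} \le N^{-16} k^{-2}$. *)
Lemma intensity_covers_tail w (N : nat) : (0 < N)%N ->
  (mu [set b | covers b w /\ (N%:R <= radius b)%R] <= (32 * c / N%:R ^+ 16)%:E)%E.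
Proof.
move=> N0; have NR : 0 < N%:R :> R by rewrite ltr0n.
have mA : measurable [set b | covers b w /\ N%:R <= radius b].
  by apply: measurableI; [exact: measurable_covers|exact: measurable_ge_radius].
have sub : [set b | covers b w /\ N%:R <= radius b] `<=`
    \bigcup_(k in ~` `I_N) shell w k.
  move=> b [/[dup] /coversE[r0 _] /covers_in_shell h Nr].
  exists (Num.trunc (radius b)) => //=; rewrite /mkset.
  by apply/negP; rewrite -leqNgt Num.Theory.truncn_ge_nat.
have := measure_sigma_subadditive_tail mu (measurable_shell w) mA sub.
move=> /le_trans; apply.
apply: lime_le.
  by apply: is_cvg_ereal_nneg_natsum_cond => n _ _; exact: measure_ge0.
apply: nearW => n.
apply: (@le_trans _ _ (\sum_(N <= k < n) (16 * c / N%:R ^+ 16 * (k%:R ^+ 2)^-1)%:E)%E).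
  rewrite big_nat_cond [leRHS]big_nat_cond; apply: lee_sum => k /andP[/andP[Nk _] _].
  have k0 : (0 < k)%N by exact: leq_trans Nk.
  apply: le_trans (intensity_shell_le w k0) _; rewrite lee_fin.
  have kR : 0 < k%:R :> R by rewrite ltr0n.
  rewrite -!mulrA; do 2 (apply: ler_wpM2l; rewrite ?(ltW c0)//).
  rewrite -invfM lef_pV2 ?posrE ?mulr_gt0 ?exprn_gt0// -[18%N]/(16 + 2)%N exprD.
  by rewrite ler_wpM2r ?sqr_ge0// lerXn2r ?nnegrE ?ler_nat.
rewrite sumEFin lee_fin -big_distrr /=.
rewrite (_ : 32 * c / N%:R ^+ 16 = 16 * c / N%:R ^+ 16 * 2); last by ring.
apply: ler_wpM2l; last exact: sum_inv_sq.
by rewrite divr_ge0// ?exprn_ge0// mulr_ge0// ltW.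
Qed.

Lemma intensity_covers_fin w : (mu [set b | covers b w] < +oo)%E.
Proof.
pose A := [set b | covers b w /\ 1%:R <= radius b].
have mA : measurable A.
  by apply: measurableI; [exact: measurable_covers|exact: measurable_ge_radius].
have sub : [set b | covers b w] `<=` shell w 0 `|` A.
  move=> b cb; have [r1|r1] := leP 1%:R (radius b); [by right|left].
  have := covers_in_shell cb; have /coversE[r0 _] := cb.
  have /andP[t _] := Num.Theory.truncn_itv r0.
  have : (Num.trunc (radius b) < 1)%N by rewrite -(ltr_nat R); exact: le_lt_trans t r1.
  by rewrite ltnS leqn0 => /eqP ->.
have mS := measurable_shell w 0.
have f1 : (mu (shell w 0) < +oo)%E.
  rewrite intensity_shell; apply: lte_mul_pinfty => //.
  by apply: (le_lt_trans (probability_le1 _ _)); rewrite ?ltry.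
have f2 : (mu A < +oo)%E by exact: le_lt_trans (intensity_covers_tail w (ltn0Sn 0)) (ltry _).
apply: le_lt_trans (le_measure mu _ _ sub) _; rewrite ?inE.
- exact: measurable_covers.
- exact: measurableU.
by apply: le_lt_trans (measureU2 _ mS mA) _; exact: lte_add_pinfty f1 f2.
Qed.

Section MarkRates.
Context (I : finType).
Implicit Types z : I -> R * R.

Definition mark_rate z (t : mark I) : R := fine (mu [set b | mark_of z b = t]).

Lemma mark_rate_ge0 z t : 0 <= mark_rate z t.
Proof. by rewrite fine_ge0. Qed.

(** Translating the sites amounts to translating the balls backwards. *)
Lemma mark_rate_translate z v t : mark_rate (fun i => z i + v) t = mark_rate z t.
Proof.
have [_ p] := preserves_translate nu v.
have e := p _ (measurable_mark (fun i => z i + v) t).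
rewrite /mark_rate -e; congr (fine (mu _)).
by apply/seteqP; split=> b /=; rewrite mark_of_translate.
Qed.

Lemma mark_covers z t b i : mark_of z b = t -> t i != None -> covers b (z i).
Proof. by move=> <-; rewrite ffunE; case: asboolP. Qed.

Lemma intensity_mark_fin z t : t != blank I -> (mu [set b | mark_of z b = t] < +oo)%E.
Proof.
move=> tb; have [i ti] : exists i, t i != None.
  apply/existsP; apply: contraNT tb => /existsPn h.
  by apply/eqP/ffunP => i; have := h i; rewrite negbK ffunE => /eqP.
apply: le_lt_trans (intensity_covers_fin (z i)).
apply: le_measure; rewrite ?inE; [exact: measurable_mark|exact: measurable_covers|].
by move=> b /= /mark_covers; exact.
Qed.

Lemma mark_rateK z t : t != blank I ->
  (mark_rate z t)%:E = mu [set b | mark_of z b = t].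
Proof. by move=> tb; rewrite fineK// ge0_fin_numE//; exact: intensity_mark_fin. Qed.

(** A ball that covers two sites separated by $g$ in the second coordinate has
    radius at least $g/2$. *)
Lemma mark_rate_hits z (F1 F2 : pred I) (g : nat) : (1 < g)%N ->
  (forall i j, F1 i -> F2 j -> g%:R <= (z j).2 - (z i).2) ->
  \sum_(t | hits F1 t && hits F2 t) mark_rate z t <=
  #|I|%:R * (32 * c * 3 ^+ 16 / g%:R ^+ 16).
Proof.
move=> g1 sep.
(* Radii are bounded below by an integer; $g/2$ rounded down is at least $g/3$. *)
pose N := (g %/ 2)%N.
have N0 : (0 < N)%N by rewrite divn_gt0.
pose A i := [set b | covers b (z i) /\ N%:R <= radius b].
have mA i : measurable (A i).
  by apply: measurableI; [exact: measurable_covers|exact: measurable_ge_radius].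
pose H := [set t | hits F1 t && hits F2 t].
have H_nb t : hits F1 t && hits F2 t -> t != blank I.
  case/andP=> /existsP[i /andP[_ ti]] _.
  by apply: contraNneq ti => ->; rewrite ffunE.
have gN : (32 * c / N%:R ^+ 16) <= 32 * c * 3 ^+ 16 / g%:R ^+ 16.
  have NR : 0 < N%:R :> R by rewrite ltr0n.
  have gR : 0 < g%:R :> R by rewrite ltr0n; lia.
  rewrite -[leRHS]mulrA; apply: ler_wpM2l; first by rewrite mulr_ge0// ltW.
  rewrite -[leLHS]mul1r ler_pdivrMr ?exprn_gt0// mulrAC ler_pdivlMr ?exprn_gt0//.
  by rewrite mul1r -exprMn lerXn2r ?nnegrE ?mulr_ge0// -natrM ler_nat /N; lia.
rewrite -lee_fin -sumEFin.
rewrite (eq_bigr (fun t => mu [set b | mark_of z b = t])); last first.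
  by move=> t /H_nb; exact: mark_rateK.
rewrite sum_measure_fin; first last.
- by move=> t _; exact: measurable_mark.
- by move=> t t' _ _ [b [/= <- <-]].
apply: (@le_trans _ _ (mu (\bigcup_(i in [set: I]) A i))).
  apply: le_measure; rewrite ?inE.
  - by apply: fin_bigcup_measurable => // t _; exact: measurable_mark.
  - by apply: fin_bigcup_measurable => // i _; exact: mA.
  move=> b [t /andP[/existsP[i /andP[Fi ti]] /existsP[j /andP[Fj tj]]] /= bt].
  exists i => //; split; first exact: mark_covers bt ti.
  have /covers_coord[_] := mark_covers bt ti; have /covers_coord[_] := mark_covers bt tj.
  have := sep _ _ Fi Fj; rewrite !ler_norml => gz /andP[a1 a2] /andP[b1 b2].
  have : N%:R * 2 <= g%:R :> R by rewrite -natrM ler_nat leq_trunc_div.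
  lra.
apply: le_trans (measure_bigcup_le _ mA) _.
apply: (@le_trans _ _ (\sum_(i : I) (32 * c * 3 ^+ 16 / g%:R ^+ 16)%:E)%E).
  apply: lee_sum => i _; apply: le_trans (intensity_covers_tail _ N0) _.
  by rewrite lee_fin.
by rewrite sumEFin sumr_const lee_fin -[leLHS]mulr_natl lexx.
Qed.

End MarkRates.

End Rates.

(** * Weight levels and the top ball *)

Section StackFirst.
Context (I : finType).

Lemma stack_none (l : seq (mark I)) i k :
  stack l i = None -> (k < size l)%N -> nth (blank I) l k i = None.
Proof.
elim: l k => [|t l IH] [|k] //=; rewrite ffunE; case: (t i) => // h kl.
exact: IH.
Qed.

Lemma stack_some (l : seq (mark I)) i c : stack l i = Some c ->
  exists2 k, (k < size l)%N & nth (blank I) l k i = Some c /\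
    forall k', (k' < k)%N -> nth (blank I) l k' i = None.
Proof.
elim: l => [|t l IH] /=; first by rewrite ffunE.
rewrite ffunE; case E: (t i) => [c'|]; first by move=> [<-]; exists 0%N.
move=> /IH[k kl [h1 h2]]; exists k.+1 => //; split=> // -[|k'] //=.
exact: h2.
Qed.

End StackFirst.

Section PointMeasure.
Context (R : realType) d d' (Omega : measurableType d) (T : measurableType d').
Context (pt : nat -> Omega -> T).
Local Notation pm := (point_measure R pt).

Let term_ge0 omega A i : (0 <= \d_(pt i omega) A :> \bar R)%E.
Proof. exact: measure_ge0. Qed.

Lemma point_measure_ge omega A n :
  (\sum_(0 <= i < n) (\d_(pt i omega) A : \bar R) <= pm omega A)%E.
Proof. by apply: nneseries_lim_ge => i _ _; exact: term_ge0. Qed.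

Lemma point_measure_mem omega A i : A (pt i omega) -> pm omega A <> 0%E.
Proof.
move=> Ai e; have := point_measure_ge omega A i.+1; rewrite e.
rewrite big_nat_recr//= diracE mem_set//.
have s0 : (0 <= \sum_(0 <= j < i) (\d_(pt j omega) A : \bar R))%E.
  by apply: sume_ge0 => j _; exact: term_ge0.
move=> h; have := le_trans (leeDr 1%:E s0) h.
by rewrite lee_fin ler10.
Qed.

Lemma point_measure_one omega A i j : pm omega A = 1%:E ->
  A (pt i omega) -> A (pt j omega) -> i = j.
Proof.
wlog ij : i j / (i <= j)%N => [H e Ai Aj|].
  by have [ij|/ltnW ji] := leqP i j; [exact: H|apply/esym; exact: H].
move=> e Ai Aj; apply/eqP; move: ij; rewrite leq_eqVlt => /orP[//|ij].
have := point_measure_ge omega A j.+1; rewrite e.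
rewrite big_nat_recr//= diracE mem_set//.
have : (1%:E <= \sum_(0 <= k < j) (\d_(pt k omega) A : \bar R))%E.
  rewrite (@big_cat_nat _ _ _ i.+1)//= big_nat_recr//= [\d_(pt i omega) A]diracE mem_set//.
  rewrite addeAC addeC -[leLHS]adde0; apply: leeD => //.
  by apply: adde_ge0; apply: sume_ge0 => k _; exact: term_ge0.
move=> h1 h2; have := le_trans (leeD2r 1%:E h1) h2.
by rewrite -EFinD lee_fin; lra.
Qed.

Lemma point_measure_ex omega A : pm omega A <> 0%E -> exists i, A (pt i omega).
Proof.
apply: contra_notP => h; rewrite /point_measure eseries0// => i _ _.
by rewrite diracE memNset// => Ai; apply: h; exists i.
Qed.

Lemma measurable_point_measure A (x : \bar R) : measurable A ->
  (forall i, measurable_fun setT (pt i)) ->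
  measurable [set omega | pm omega A = x].
Proof.
move=> mA mpt.
have mf : measurable_fun setT (fun omega => pm omega A).
  rewrite /point_measure; apply: ge0_emeasurable_sum => // i _.
  rewrite (_ : (fun omega => \d_(pt i omega) A) =
     (fun omega => (\1_A (pt i omega))%:E)); last first.
    by apply/funext => omega; rewrite diracE indicE.
  apply/measurable_EFinP.
  by apply: (@measurableT_comp _ _ _ _ _ _ (\1_A : T -> R)) => //; exact: measurable_indic.
rewrite (_ : [set _ | _] = setT `&` (fun omega => pm omega A) @^-1` [set x]); last first.
  by rewrite setTI.
apply: mf => //; exact: emeasurable_set1.
Qed.

End PointMeasure.

Section Levels.
Context (R : realType) (K : nat) (K0 : (0 < K)%N).

(** Level 0 is the top one. It alone contains its upper endpoint, so that the
    levels with $k < K$ partition $[0, 1]$. *)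
Definition weight_level (k : nat) : set (measurableTypeR R) :=
  [set w | 1 - k.+1%:R / K%:R <= w /\ (if k is 0 then w <= 1 else w < 1 - k%:R / K%:R)].

Let KR : 0 < K%:R :> R. Proof. by rewrite ltr0n. Qed.

Lemma weight_level_lt k k' (w w' : R) : (k < k')%N ->
  weight_level k w -> weight_level k' w' -> w' < w.
Proof.
case: k' => // k' kk [w1 _] [_ w2]; apply: lt_le_trans w2 (le_trans _ w1).
by rewrite lerB// ler_pM2r ?invr_gt0// ler_nat.
Qed.

Lemma weight_level_ex (w : R) : 0 <= w <= 1 -> exists k : 'I_K, weight_level k w.
Proof.
move=> /andP[w0 w1].
have ex : exists k, 1 - k.+1%:R / K%:R <= w.
  by exists K.-1; rewrite prednK// divff ?gt_eqF// subrr.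
case: (ex_minnP ex) => k hk kmin.
have kK : (k < K)%N.
  by apply: leq_ltn_trans (kmin K.-1 _) _; rewrite ?prednK// ?divff ?gt_eqF// ?subrr.
exists (Ordinal kK); split=> //=; case: k hk kmin kK => // k hk kmin kK.
by rewrite ltNge; apply/negP => /kmin; rewrite ltnn.
Qed.

Lemma weight_levelE k : weight_level k =
  [set` Interval (BLeft (1 - k.+1%:R / K%:R))
    (if k is 0 then BRight 1 else BLeft (1 - k%:R / K%:R))].
Proof.
apply/seteqP; split=> w; rewrite /weight_level /= in_itv /=; case: k => [|k] /=.
- by move=> [-> ->].
- by move=> [-> ->].
- by move=> /andP.
- by move=> /andP.
Qed.

Lemma measurable_weight_level k : measurable (weight_level k).
Proof. by rewrite weight_levelE. Qed.

Lemma uniform_weight_level (k : 'I_K) :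
  uniform_prob (@ltr01 R) (weight_level k) = (K%:R^-1)%:E.
Proof.
have kK : k.+1%:R / K%:R <= 1 :> R by rewrite ler_pdivrMr// mul1r ler_nat.
have e : k.+1%:R / K%:R = k%:R / K%:R + K%:R^-1 :> R by rewrite -natr1 mulrDl mul1r.
have k0 : 0 <= k%:R / K%:R :> R by rewrite divr_ge0.
have Kv : 0 < K%:R^-1 :> R by rewrite invr_gt0.
have sub (w : R) : weight_level k w -> 0 <= w <= 1.
  case=> h1; case: (nat_of_ord k) k0 => [|k'] k0' h2; apply/andP; split; lra.
rewrite /uniform_prob (eq_integral (cst 1%:E)); last first.
  by move=> w; rewrite inE => /sub h; rewrite /uniform_pdf h subr0 invr1.
rewrite integral_cst//; last exact: measurable_weight_level.
rewrite mul1e weight_levelE /= lebesgue_measure_itv /=.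
case: (nat_of_ord k) e k0 => [|k'] e k0 /=; rewrite lte_fin ifT.
- by rewrite -EFinD; congr EFin; rewrite e mul0r; lra.
- by rewrite e mul0r; lra.
- by rewrite -EFinD; congr EFin; rewrite e; lra.
- by rewrite e; lra.
Qed.

End Levels.

Section SignOfConfetti.
Context (R : realType).
Implicit Types (bs : nat -> ball_type R) (w : R * R).

Definition sign_opt (x : R) : option bool :=
  if 0 < x then Some true else if x < 0 then Some false else None.

Lemma is_top_uniq bs w i j : is_top bs w i -> is_top bs w j -> i = j.
Proof.
move=> [ci ti] [cj tj]; apply/eqP/negPn/negP => /eqP ij.
have := lt_trans (ti j (nesym ij) cj) (tj i ij ci).
by rewrite ltxx.
Qed.

Lemma confetti_top bs w i : is_top bs w i -> confetti bs w = color (bs i).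
Proof.
move=> ti; rewrite /confetti /top_index asboolT; last by exists i.
by rewrite (is_top_uniq (@xgetPex _ 0%N (is_top bs w) _) ti)//; exists i.
Qed.

Lemma confetti_no_top bs w : (forall i, ~ is_top bs w i) -> confetti bs w = 0.
Proof. by move=> h; rewrite /confetti /top_index asboolF// => -[i /h]. Qed.

Lemma sign_opt_color b : ball_space b -> sign_opt (color b) = Some (0 < color b).
Proof. by case=> _ [] -> _; rewrite /sign_opt ?ltr01// ltr0N1 ltrN10. Qed.

Section Sites.
Context (I : finType) (z : I -> R * R).

Definition sign_mark bs : mark I := [ffun i => sign_opt (confetti bs (z i))].

(** The balls of mark $t$ and level $k$. Balls without a covered site have
    infinite intensity; their cells are replaced by empty ones, so that every
    cell has finite intensity. *)
Definition cell (K k : nat) (t : mark I) : set (ball_type R) :=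
  if t == blank I then set0
  else [set b | mark_of z b = t] `&` [set b | weight_level K k (weight b)].

(** If every level holds at most one ball that covers a site, then at each site
    the highest level that shows a colour holds the ball of maximal weight, and
    it holds no other ball that covers the site. *)
Lemma sign_mark_stack d (Omega : measurableType d) (pt : nat -> Omega -> ball_type R)
    (omega : Omega) (K : nat) (l : K.-tuple (mark I)) : (0 < K)%N ->
  (forall i, ball_space (pt i omega)) ->
  (forall (k : 'I_K) (t : mark I), point_measure R pt omega (cell K k t) =
     ((t != blank I) && (tnth l k == t))%:R%:E) ->
  sign_mark (pt ^~ omega) = stack l.
Proof.
move=> K0 bS cnt; apply/ffunP => i; rewrite ffunE.
set bs := pt ^~ omega.
have loc j : covers (bs j) (z i) -> exists k : 'I_K,
    [/\ weight_level K k (weight (bs j)), tnth l k = mark_of z (bs j),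
        cell K k (tnth l k) (bs j) & tnth l k i = Some (0 < color (bs j))].
  move=> cj; have [_ _ w01] := bS j.
  have [k wk] := weight_level_ex K0 w01.
  pose t := mark_of z (bs j).
  have ti : t i = Some (0 < color (bs j)) by rewrite ffunE asboolT.
  have tb : t != blank I by apply/eqP => e; move: ti; rewrite e ffunE.
  have ct : cell K k t (bs j) by rewrite /cell (negbTE tb).
  have lk : tnth l k = t.
    apply/eqP/negPn/negP => h.
    by apply: (point_measure_mem (R := R) ct); rewrite cnt tb (negbTE h).
  by exists k; rewrite lk; split.
have tn (k : 'I_K) : tnth l k = nth (blank I) l k by exact: tnth_nth.
case E : (stack l i) => [c|].
  have [k kl [hk hlt]] := stack_some E; rewrite size_tuple in kl.
  pose k' : 'I_K := Ordinal kl.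
  have lk' : tnth l k' i = Some c by rewrite tn.
  have nb : tnth l k' != blank I.
    by apply/eqP => e; move: lk'; rewrite e ffunE.
  have cnt1 := cnt k' (tnth l k'); rewrite nb eqxx in cnt1.
  have [j cj] : exists j, cell K k' (tnth l k') (bs j).
    by apply: (@point_measure_ex R); rewrite cnt1 => /eqP; rewrite eqe oner_eq0.
  have [mj wj] : mark_of z (bs j) = tnth l k' /\ weight_level K k' (weight (bs j)).
    by move: cj; rewrite /cell (negbTE nb).
  have mjc : (if `[< covers (bs j) (z i) >] then Some (0 < color (bs j)) else None) = Some c.
    by rewrite -lk' -mj ffunE.
  move: mjc; case: asboolP => // covj [cc].
  rewrite (@confetti_top _ _ j); first by rewrite (sign_opt_color (bS j)) cc.
  split=> // j' jj' covj'.
  have [k2 [w2 m2 c2 l2]] := loc _ covj'.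
  have [klt|kgt|/val_inj keq] := ltngtP k' k2.
  - by have := weight_level_lt K0 klt wj w2.
  - by have := hlt _ kgt; rewrite -tn l2.
  - by case: jj'; rewrite -keq in c2; exact: (point_measure_one cnt1).
rewrite confetti_no_top /sign_opt ?ltxx// => j [cj _].
have [k [_ _ _]] := loc _ cj.
by rewrite tn (stack_none E)// size_tuple.
Qed.

Lemma cell_disjoint (K : nat) (K0 : (0 < K)%N) (c1 c2 : nat * mark I) b :
  cell K c1.1 c1.2 b -> cell K c2.1 c2.2 b -> c1 = c2.
Proof.
case: c1 c2 => [k1 t1] [k2 t2]; rewrite /cell /=.
case: ifP => // _ [/= m1 w1]; case: ifP => // _ [/= m2 w2].
congr (_, _); last by rewrite -m1 -m2.
have [kk|kk|//] := ltngtP k1 k2.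
  by have := weight_level_lt K0 kk w1 w2; rewrite ltxx.
by have := weight_level_lt K0 kk w2 w1; rewrite ltxx.
Qed.

Lemma measurable_cell K k t : measurable (cell K k t).
Proof.
rewrite /cell; case: ifP => // _; apply: measurableI; first exact: measurable_mark.
have := @measurable_snd _ _ (measurableTypeR R * measurableTypeR R * measurableTypeR R *
  measurableTypeR R)%type (measurableTypeR R).
move=> /(_ measurableT _ (measurable_weight_level K k)).
by rewrite setTI.
Qed.

Context (nu : probability (measurableTypeR R) R).
Local Notation mu := (confetti_intensity nu).

(** The mark of a ball does not depend on its weight. *)
Lemma intensity_cell K (k : 'I_K) t : (0 < K)%N -> t != blank I ->
  mu (cell K k t) = (mu [set b | mark_of z b = t] * (K%:R^-1)%:E)%E.
Proof.
move=> K0 tb; rewrite /cell (negbTE tb).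
pose A : set (measurableTypeR R * measurableTypeR R * measurableTypeR R * measurableTypeR R) :=
  [set p | mark_of z (p, 0) = t].
have markE b : mark_of z b = mark_of z (b.1, 0) by apply/ffunP => i; rewrite !ffunE.
have mA : measurable A.
  have mp : measurable_fun setT (fun p : measurableTypeR R * measurableTypeR R *
      measurableTypeR R * measurableTypeR R => (p, 0 : measurableTypeR R)).
    by apply: measurable_fun_pair; [exact: measurable_id|exact: measurable_cst].
  have := mp measurableT _ (measurable_mark z t); rewrite setTI; exact.
rewrite (_ : _ `&` _ = A `*` weight_level K k); last first.
  by apply/seteqP; split=> b [h1 h2]; split=> //; move: h1; rewrite /A /= -?markE// markE.
rewrite intensity_weight//; last exact: measurable_weight_level.
congr (_ * _)%E; last exact: uniform_weight_level.
rewrite (_ : A `*` setT = [set b | mark_of z b = t])//.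
apply/seteqP; split=> b; first by case; rewrite /A /= -markE.
by move=> h; split=> //; rewrite /A /= -markE.
Qed.

End Sites.

End SignOfConfetti.

(** * Law of the confetti signs on finitely many sites *)

Section FieldLaw.
Context (R : realType) (nu : probability (measurableTypeR R) R).
Context (c alpha : R) (c0 : 0 < c) (alpha20 : 20 <= alpha).
Context (nu_tail : forall r : R, 0 < r ->
  (nu `[r, +oo[%classic <= (c * r `^ (- alpha))%:E)%E).
Context (d : measure_display) (Omega : measurableType d) (P : probability Omega R).
Context (pt : nat -> Omega -> ball_type R).
Context (pt_space : forall i omega, ball_space (pt i omega)).
Context (ppp : poisson_point_process P (confetti_intensity nu) pt).
Local Notation mu := (confetti_intensity nu).
Implicit Types w : R * R.

Let mpt i : measurable_fun setT (pt i). Proof. exact: (ppp_measurable ppp). Qed.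

Let mpre i (A : set (ball_type R)) : measurable A -> measurable [set omega | A (pt i omega)].
Proof. by move=> mA; have := mpt i measurableT mA; rewrite setTI. Qed.

(** Compared with each of the countably many other balls, the ball $i$ has the
    larger weight or the other ball misses $w$. *)
Lemma measurable_is_top w i : measurable [set omega | is_top (pt ^~ omega) w i].
Proof.
rewrite (_ : [set _ | _] = [set omega | covers (pt i omega) w] `&`
  \bigcap_j ([set omega | j = i] `|` (~` [set omega | covers (pt j omega) w] `|`
    [set omega | weight (pt j omega) < weight (pt i omega)]))).
  have mcov j : measurable [set omega | covers (pt j omega) w].
    exact: (@mpre j _ (measurable_covers w)).
  have mcst (Q : Prop) : measurable [set _ : Omega | Q].
    have [q|q] := pselect Q.
      by rewrite (_ : [set _ | _] = setT)//; apply/seteqP; split.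
    by rewrite (_ : [set _ | _] = set0)//; apply/seteqP; split.
  apply: measurableI; first exact: mcov.
  apply: bigcapT_measurable => j; apply: measurableU; first exact: mcst.
  apply: measurableU; first exact: measurableC.
  have mw k : measurable_fun setT (fun omega => weight (pt k omega)).
    by apply: (@measurableT_comp _ _ _ _ _ _ (@weight R)) => //; exact: measurable_snd.
  rewrite (_ : [set omega | _] =
      ~` [set omega | weight (pt i omega) <= weight (pt j omega)]); last first.
    by apply/seteqP; split=> omega /=; rewrite ltNge => /negP.
  by apply: measurableC; rewrite -[X in measurable X]setTI; exact: measurable_fun_le.
apply/seteqP; split=> omega /=.
  move=> [ci h]; split=> // j _ /=.
  have [->|/eqP ji] := eqVneq j i; [by left|right].
  by have [cj|] := pselect (covers (pt j omega) w); [right; exact: h|left].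
move=> [ci h]; split=> // j ji cj.
by have [/=|[|]] := h j I.
Qed.

Lemma measurable_top_color w (Q : set (ball_type R)) : measurable Q ->
  measurable [set omega | exists2 i, is_top (pt ^~ omega) w i & Q (pt i omega)].
Proof.
move=> mQ; rewrite (_ : [set _ | _] = \bigcup_i
    ([set omega | is_top (pt ^~ omega) w i] `&` [set omega | Q (pt i omega)])).
  by apply: bigcupT_measurable => i; apply: measurableI;
    [exact: measurable_is_top|exact: mpre].
by apply/seteqP; split=> omega /= [i]; [exists i|move=> _ []; exists i].
Qed.

Lemma measurable_sign_opt w o :
  measurable [set omega | sign_opt (confetti (pt ^~ omega) w) = o].
Proof.
pose pos := [set b : ball_type R | 0 < color b].
have mpos : measurable pos by exact: measurable_pos_color.
pose T := [set omega | exists2 i, is_top (pt ^~ omega) w i & pos (pt i omega)].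
pose F := [set omega | exists2 i, is_top (pt ^~ omega) w i & (~` pos) (pt i omega)].
have mT : measurable T by exact: measurable_top_color.
have mF : measurable F by apply: measurable_top_color; exact: measurableC.
have val omega : sign_opt (confetti (pt ^~ omega) w) =
    if `[< T omega >] then Some true else if `[< F omega >] then Some false else None.
  case: asboolP => [[i ti /= pi]|nT].
    by rewrite (confetti_top ti) sign_opt_color// pi.
  case: asboolP => [[i ti /= /negP/negbTE pi]|nF].
    by rewrite (confetti_top ti) sign_opt_color// pi.
  rewrite confetti_no_top /sign_opt ?ltxx// => i ti.
  have [pi|npi] := pselect (pos (pt i omega)); first by apply: nT; exists i.
  by apply: nF; exists i.
have disj omega : T omega -> F omega -> False.
  by move=> [i ti pi] [j tj]; rewrite (is_top_uniq tj ti).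
case: o => [[]|].
- rewrite (_ : [set _ | _] = T)//; apply/seteqP; split=> omega /=; rewrite val.
    by case: asboolP => // _; case: asboolP.
  by move=> t; rewrite asboolT.
- rewrite (_ : [set _ | _] = F)//; apply/seteqP; split=> omega /=; rewrite val.
    by case: asboolP => // _; case: asboolP.
  by move=> f; rewrite asboolF; [rewrite asboolT|move=> t; exact: disj t f].
- rewrite (_ : [set _ | _] = ~` (T `|` F)); first by apply: measurableC; exact: measurableU.
  apply/seteqP; split=> omega /=; rewrite val.
    by case: asboolP => // nt; case: asboolP => // nf _ [].
  by move=> /not_orP[nt nf]; rewrite !asboolF.
Qed.

Section Sites.
Context (I : finType).
Implicit Types z : I -> R * R.

Lemma measurable_sign_mark z s : measurable [set omega | sign_mark z (pt ^~ omega) = s].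
Proof.
rewrite (_ : [set _ | _] = \bigcap_(i in [set: I])
    [set omega | sign_opt (confetti (pt ^~ omega) (z i)) = s i]).
  by apply: fin_bigcap_measurable => // i _; exact: measurable_sign_opt.
apply/seteqP; split=> omega /= h; first by move=> i _ /=; rewrite -h ffunE.
by apply/ffunP => i; rewrite ffunE; exact: h.
Qed.

Definition field_prob z (s : mark I) : R :=
  fine (P [set omega | sign_mark z (pt ^~ omega) = s]).

Lemma field_probK z s :
  (field_prob z s)%:E = P [set omega | sign_mark z (pt ^~ omega) = s].
Proof. by rewrite fineK// fin_num_measure//; exact: measurable_sign_mark. Qed.

Lemma field_prob_ge0 z s : 0 <= field_prob z s.
Proof. by rewrite fine_ge0. Qed.

Lemma field_prob_sum z : \sum_s field_prob z s = 1.
Proof.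
apply: EFin_inj; rewrite -sumEFin.
rewrite (eq_bigr _ (fun s _ => field_probK z s)) sum_measure_fin.
- rewrite -(probability_setT P); congr (P _); apply/seteqP; split=> // omega _.
  by exists (sign_mark z (pt ^~ omega)).
- by move=> s s' _ _ [omega [/= <- <-]].
- by move=> s _; exact: measurable_sign_mark.
Qed.

Lemma cell_rate z K (k : 'I_K) t : (0 < K)%N ->
  mu (cell z K k t) = (if t == blank I then 0 else mark_rate nu z t / K%:R)%:E.
Proof.
move=> K0; case: ifPn => [/eqP ->|tb]; first by rewrite /cell eqxx measure0.
rewrite intensity_cell// EFinM; congr (_ * _)%E.
by rewrite (mark_rateK c0 alpha20 nu_tail).
Qed.

(** A blank mark in $l$ prescribes a level without any ball that covers a site. *)
Definition stack_event z K (l : K.-tuple (mark I)) : set Omega :=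
  [set omega | forall (k : 'I_K) t, point_measure R pt omega (cell z K k t) =
    ((t != blank I) && (tnth l k == t))%:R%:E].

(** The counts of the cells are independent Poisson variables, and the empty
    blank cells contribute the factor 1. *)
Lemma stack_event_prob z K (l : K.-tuple (mark I)) : (0 < K)%N ->
  P (stack_event z l) = (\prod_(t <- l) level_mass (mark_rate nu z) K t)%:E.
Proof.
move=> K0.
pose J := ('I_K * mark I)%type.
pose A (j : 'I_#|{: J}|) := cell z K (enum_val j).1 (enum_val j).2.
pose hit (x : J) : nat := ((x.2 != blank I) && (tnth l x.1 == x.2)).
have mA j : measurable (A j) by exact: measurable_cell.
have fA j : (mu (A j) < +oo)%E by rewrite cell_rate// ltry.
have tA : trivIset setT A.
  move=> j j' _ _ [b [h1 h2]]; apply: enum_val_inj.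
  move: h1 h2; rewrite /A; case: (enum_val j) => k t; case: (enum_val j') => k' t'.
  move=> h1 h2; have := @cell_disjoint _ _ z K K0 (k : nat, t) (k' : nat, t') b h1 h2.
  by case=> /val_inj -> ->.
have H := ppp_counts ppp (fun j => hit (enum_val j)) mA fA tA.
rewrite (_ : stack_event z l = [set omega | forall j, point_measure R pt omega (A j) =
    (hit (enum_val j))%:R%:E]); last first.
  apply/seteqP; split=> omega /= h; first by move=> j; exact: h.
  by move=> k t; have := h (enum_rank (k, t)); rewrite /A /hit enum_rankK.
rewrite H; congr EFin.
rewrite -(big_enum_val (fun x : J =>
   poisson_mass (fine (mu (cell z K x.1 x.2))) (hit x))) /=.
rewrite (eq_bigl xpredT) // -(pair_bigA _ (fun (k : 'I_K) t =>
   poisson_mass (fine (mu (cell z K k t))) (hit (k, t)))) /=.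
rewrite big_tuple; apply: eq_bigr => k _.
rewrite (eq_bigr (fun t => poisson_mass
   (if t == blank I then 0 else mark_rate nu z t / K%:R) (hit (k, t)))); last first.
  by move=> t _; rewrite cell_rate.
rewrite (bigD1 (blank I)) //= eqxx {1}/hit /= eqxx /poisson_mass expr0 oppr0 expR0.
rewrite fact0 !mul1r invr1 mul1r.
rewrite (eq_bigr (fun t => expR (- (mark_rate nu z t / K%:R)) *
   (if t == tnth l k then mark_rate nu z t / K%:R else 1))); last first.
  move=> t tb; rewrite /hit /= tb (negbTE tb) /= eq_sym.
  case: ifP => _ /=; first by rewrite expr1 (_ : 1`! = 1%N)// divr1 mulrC.
  by rewrite expr0 fact0 divr1 mulrC.
rewrite big_split mul1r /= /level_mass; congr (_ * _).
  rewrite -expR_sum /total_rate sumrN; congr (expR (- _)).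
  by rewrite big_distrl.
case: ifPn => [/eqP e|nb].
  by rewrite big1// => t tb; rewrite e (negbTE tb).
rewrite (bigD1 (tnth l k)) //= eqxx big1 ?mulr1// => t /andP[_ /negbTE ->]//.
Qed.

(** The stack events are disjoint, and on each of them the signs are the stack. *)
Lemma field_prob_stack z K s : (0 < K)%N ->
  \sum_(l : K.-tuple (mark I) | stack l == s)
    (\prod_(t <- l) level_mass (mark_rate nu z) K t) <= field_prob z s.
Proof.
move=> K0; rewrite -lee_fin field_probK -sumEFin.
rewrite (eq_bigr _ (fun l _ => esym (stack_event_prob z l K0))).
have mE (l : K.-tuple (mark I)) : measurable (stack_event z l).
  rewrite (_ : stack_event z l = \bigcap_(x in [set: 'I_K * mark I])
      [set omega | point_measure R pt omega (cell z K x.1 x.2) =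
         ((x.2 != blank I) && (tnth l x.1 == x.2))%:R%:E]).
    apply: fin_bigcap_measurable; [exact: (@finite_finset ('I_K * mark I)%type)|move=> x _].
    by apply: measurable_point_measure => //; exact: measurable_cell.
  apply/seteqP; split=> omega /= h; first by move=> x _; exact: h.
  by move=> k t; exact: (h (k, t)).
rewrite sum_measure_fin //.
  apply: le_measure; rewrite ?inE.
  - by apply: fin_bigcup_measurable => //.
  - exact: measurable_sign_mark.
  - move=> omega [l /= /eqP <-] h.
    by apply: sign_mark_stack => // i; exact: pt_space.
move=> l l' _ _ [omega [h h']]; apply: eq_from_tnth => k.
have one (m m' : K.-tuple (mark I)) : stack_event z m omega -> stack_event z m' omega ->
    tnth m k != blank I -> tnth m k = tnth m' k.
  move=> hm hm' nb; have := hm' k (tnth m k); rewrite (hm k (tnth m k)) nb eqxx /=.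
  case: eqP => [-> //|_] /eqP; by rewrite eqe oner_eq0.
have [e|nb] := eqVneq (tnth l k) (blank I); last exact: one nb.
have [e'|nb] := eqVneq (tnth l' k) (blank I); first by rewrite e e'.
by apply/esym; exact: one nb.
Qed.

Lemma field_prob_near z K g (B : R) : (0 < K)%N ->
  total_rate (mark_rate nu z) <= K%:R -> (forall s, `|g s| <= B) ->
  `|\sum_s field_prob z s * g s - stack_mean (level_law (mark_rate nu z) K) K g| <=
  B * (3 * total_rate (mark_rate nu z) ^+ 2) / K%:R.
Proof.
move=> K0 MK gB; apply: stack_law_near => //.
- by move=> t; exact: mark_rate_ge0.
- exact: field_prob_sum.
- by move=> s; exact: field_prob_stack.
Qed.

End Sites.

End FieldLaw.

(** * The confetti signs form a decoupling field *)

Lemma le_of_large (R : realType) (x y C : R) (K0 : nat) :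
  (forall K, (K0 < K)%N -> x <= y + C / K%:R) -> x <= y.
Proof.
move=> H; apply/ler_addgt0Pr => e e0.
have C0 : 0 <= `|C| / e by rewrite divr_ge0// ltW.
pose K := (K0 + Num.bound (`|C| / e)).+1.
have KR : 0 < K%:R :> R by rewrite ltr0n.
apply: le_trans (H K _) _; first by rewrite /K ltnS leq_addr.
rewrite lerD2l ler_pdivrMr//; apply: le_trans (ler_norm C) _.
rewrite mulrC -ler_pdivrMr//; apply: le_trans (ltW (archi_boundP C0)) _.
by rewrite ler_nat /K; lia.
Qed.

Section BoxFields.
Context (N : nat).

Definition box_index := ('I_(2 * N).+1 * 'I_N)%type.

Definition box_site (i : box_index) : int * nat := ((i.1 : nat)%:Z - N%:Z, i.2 : nat).

Lemma box_site_inj : injective box_site.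
Proof.
move=> [i1 i2] [j1 j2] [e1 e2]; congr (_, _); apply: val_inj => //=.
by move: e1; lia.
Qed.

Lemma box_site_ex (x : int) t : (`|x| <= N)%N -> (t < N)%N ->
  exists i, box_site i = (x, t).
Proof.
move=> xN tN; have h : (absz (x + N%:Z)%R < (2 * N).+1)%N by lia.
exists (Ordinal h, Ordinal tN); rewrite /box_site /=; congr (_, _); lia.
Qed.

Lemma box_site_in i : (`|(box_site i).1| <= N)%N /\ ((box_site i).2 < N)%N.
Proof.
case: i => [[i hi] [t ht]]; rewrite /box_site /=; split=> //; lia.
Qed.

(** Blank outside the box; only functions that do not look there will be
    applied. *)
Definition box_field (s : mark box_index) : sign_field :=
  fun x t => if [pick i | box_site i == (x, t)] is Some i then s i else None.

Lemma box_fieldE s i : box_field s (box_site i).1 (box_site i).2 = s i.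
Proof.
rewrite /box_field; case: pickP => [j /eqP|/(_ i)]; rewrite -surjective_pairing.
  by move/box_site_inj ->.
by rewrite eqxx.
Qed.

End BoxFields.

Section ConfettiField.
Context (R : realType) (nu : probability (measurableTypeR R) R).
Context (c alpha : R) (c0 : 0 < c) (alpha20 : 20 <= alpha).
Context (nu_tail : forall r : R, 0 < r ->
  (nu `[r, +oo[%classic <= (c * r `^ (- alpha))%:E)%E).
Context (d : measure_display) (Omega : measurableType d) (P : probability Omega R).
Context (pt : nat -> Omega -> ball_type R).
Context (pt_space : forall i omega, ball_space (pt i omega)).
Context (ppp : poisson_point_process P (confetti_intensity nu) pt).
Local Notation near_stack := (field_prob_near c0 alpha20 nu_tail pt_space ppp).
Local Notation rate := (mark_rate nu).

(** Both laws are limits of laws of stacks of independent marks, and the rates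
    of the marks do not change under translation. *)
Lemma field_prob_translate (I : finType) (z : I -> R * R) (v : R * R) (g : mark I -> R) :
  \sum_s field_prob P pt (fun i => z i + v) s * g s = \sum_s field_prob P pt z s * g s.
Proof.
pose B := \sum_s `|g s|.
have gB s : `|g s| <= B by rewrite /B (bigD1 s)//= lerDl sumr_ge0.
have erate : rate (fun i => z i + v) = rate z.
  by apply/funext => t; exact: mark_rate_translate.
set M := total_rate (rate z).
have M0 : 0 <= M by apply: total_rate_ge0 => t; exact: mark_rate_ge0.
apply/eqP; rewrite -subr_eq0 -normr_le0.
apply: (@le_of_large _ _ _ (2 * (B * (3 * M ^+ 2))) (Num.bound M)) => K KM.
have K0 : (0 < K)%N by exact: leq_ltn_trans KM.
have MK : M <= K%:R.
  have b := archi_boundP M0; apply: (le_trans (ltW b)).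
  by rewrite ler_nat ltnW.
have h1 := near_stack K0 MK gB.
have := near_stack (z := fun i => z i + v) K0 _ gB.
rewrite erate => /(_ MK) h2.
rewrite -/M in h1 h2; set X := B * (3 * M ^+ 2) in h1 h2 *.
rewrite (_ : 0 + 2 * X / K%:R = X / K%:R + X / K%:R); last by ring.
apply: le_trans (lerD h2 h1).
rewrite -[X in `|X| <= _](subrKA (stack_mean (level_law (rate z) K) K g)).
by rewrite (distrC (\sum_s field_prob P pt z s * g s)) ler_normD.
Qed.

Lemma field_prob_marginal (I J : finType) (z : I -> R * R) (iota : J -> I) (g : mark J -> R) :
  \sum_s field_prob P pt z s * g [ffun j => s (iota j)] =
  \sum_s field_prob P pt (fun j => z (iota j)) s * g s.
Proof.
pose r (s : mark I) : mark J := [ffun j => s (iota j)].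
rewrite (partition_big r xpredT) //=; apply: eq_bigr => t _.
rewrite (eq_bigr (fun s => field_prob P pt z s * g t)); last first.
  by move=> s /eqP <-.
rewrite -big_distrl /=; congr (_ * _); apply: EFin_inj.
rewrite (field_probK pt_space ppp) -sumEFin.
rewrite (eq_bigr _ (fun s _ => field_probK pt_space ppp z s)).
rewrite sum_measure_fin.
- congr (P _); apply/seteqP; split=> omega /=.
    move=> [s /= /eqP <- <-]; apply/ffunP => j; by rewrite !ffunE.
  move=> h; exists (sign_mark z (pt ^~ omega)) => //=; apply/eqP.
  by rewrite -h; apply/ffunP => j; rewrite !ffunE.
- by move=> s s' _ _ [omega [/= <- <-]].
- by move=> s _; exact: (measurable_sign_mark pt_space ppp).
Qed.

(** For stacks of $K$ independent marks this is [stack_mean_decouple], with $K$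
    times the rate at which a single mark hits both regions; the contribution of
    two marks is of order $1/K$ in total and vanishes in the limit. *)
Lemma field_prob_mix (I : finType) (z : I -> R * R) (F1 F2 : pred I) (g : nat)
    (Phi : mark I -> mark I -> R) (B : R) : (1 < g)%N ->
  (forall i j, F1 i -> F2 j -> g%:R <= (z j).2 - (z i).2) ->
  local2 F1 F2 Phi -> (forall s t, `|Phi s t| <= B) ->
  `|\sum_s field_prob P pt z s * Phi s s -
    \sum_s field_prob P pt z s * (\sum_t field_prob P pt z t * Phi s t)| <=
  4 * B * (#|I|%:R * (32 * c * 3 ^+ 16 / g%:R ^+ 16)).
Proof.
move=> g1 sep loc PB.
have B0 : 0 <= B := le_trans (normr_ge0 _) (PB (blank I) (blank I)).
set M := total_rate (rate z); set eta := (#|I|%:R * _).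
have r0 t : 0 <= rate z t by exact: mark_rate_ge0.
have M0 : 0 <= M by exact: total_rate_ge0.
have eta_ge : \sum_(t | hits F1 t && hits F2 t) rate z t <= eta.
  exact: (mark_rate_hits c0 alpha20 nu_tail).
apply: (@le_of_large _ _ _ (13 * (B * M ^+ 2)) (Num.bound M)) => K KM.
have K0 : (0 < K)%N by exact: leq_ltn_trans KM.
have KR : 0 < K%:R :> R by rewrite ltr0n.
have MK : M <= K%:R.
  have b := archi_boundP M0; apply: (le_trans (ltW b)).
  by rewrite ler_nat ltnW.
set m := level_law (rate z) K; pose SM := stack_mean m K.
have m0 t : 0 <= m t by exact: level_law_ge0.
have m1 : \sum_t m t = 1 by exact: level_law_sum.
have m1' : \sum_t m t <= 1 by rewrite m1.
set C := B * (3 * M ^+ 2) / K%:R.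
have C0 : 0 <= C by rewrite /C !mulr_ge0 ?invr_ge0 ?exprn_ge0// ltW.
have f0 s : 0 <= field_prob P pt z s by exact: field_prob_ge0.
have f1 : \sum_s field_prob P pt z s = 1 by exact: (field_prob_sum pt_space ppp).
have e1 : `|\sum_s field_prob P pt z s * Phi s s - SM (fun s => Phi s s)| <= C.
  by apply: (near_stack K0 MK) => s; exact: PB.
have e2 : `|\sum_s field_prob P pt z s * (\sum_t field_prob P pt z t * Phi s t) -
    \sum_s field_prob P pt z s * SM (Phi s)| <= C.
  rewrite -sumrB; apply: le_trans (ler_norm_sum _ _ _) _.
  rewrite [leRHS](_ : C = \sum_s field_prob P pt z s * C); last first.
    by rewrite -big_distrl /= f1 mul1r.
  apply: ler_sum => s _; rewrite -mulrBr normrM (ger0_norm (f0 s)).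
  by apply: ler_wpM2l => //; apply: (near_stack K0 MK) => t; exact: PB.
have e3 : `|\sum_s field_prob P pt z s * SM (Phi s) - SM (fun s => SM (Phi s))| <= C.
  by apply: (near_stack K0 MK) => s; apply: stack_mean_norm.
have e4 : `|SM (fun s => Phi s s) - SM (fun s => SM (Phi s))| <=
    K%:R * (4 * B * mix_rate F1 F2 m).
  exact: stack_mean_decouple.
have hm (F : pred I) t : hits F t -> m t = rate z t / K%:R.
  move=> /existsP[i /andP[_ ti]]; rewrite /m /level_law ifF//.
  by apply/eqP => e; move: ti; rewrite e ffunE.
have one (F : pred I) : \sum_(t | hits F t) m t <= M / K%:R.
  rewrite (eq_bigr (fun t => rate z t / K%:R)); last by move=> t /hm.
  rewrite -big_distrl /= ler_pM2r ?invr_gt0// /M /total_rate.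
  rewrite big_mkcond [leRHS]big_mkcond; apply: ler_sum => t _.
  case: ifP => [/existsP[i /andP[_ ti]]|_]; last by case: ifP.
  by rewrite ifT//; apply: contraNneq ti => ->; rewrite ffunE.
have rateK : mix_rate F1 F2 m <= eta / K%:R + M / K%:R * (M / K%:R).
  rewrite /mix_rate; apply: lerD.
    rewrite (eq_bigr (fun t => rate z t / K%:R)); last by move=> t /andP[/hm].
    by rewrite -big_distrl /= ler_pM2r ?invr_gt0.
  by apply: ler_pM; rewrite ?sumr_ge0//; exact: one.
have e5 : K%:R * (4 * B * mix_rate F1 F2 m) <= 4 * B * eta + 4 * (B * M ^+ 2 / K%:R).
  apply: (@le_trans _ _ (K%:R * (4 * B * (eta / K%:R + M / K%:R * (M / K%:R))))).
    by apply: ler_wpM2l => //; apply: ler_wpM2l => //; rewrite mulr_ge0.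
  rewrite [leLHS](_ : _ = 4 * B * eta + 4 * (B * M ^+ 2 / K%:R))//.
  by field; rewrite gt_eqF.
have eC : C = 3 * (B * M ^+ 2 / K%:R) by rewrite /C; ring.
set X := B * M ^+ 2 / K%:R in e5 eC.
rewrite (_ : 13 * (B * M ^+ 2) / K%:R = 13 * X); last by rewrite /X; ring.
move: e1 e2 e3 e4; rewrite !ler_norml.
move=> /andP[? ?] /andP[? ?] /andP[? ?] /andP[? ?]; apply/andP; split; lra.
Qed.

Definition real_site (i : int * nat) : R * R := (i.1%:~R, i.2%:R).

(** A finite sum rather than an integral over $\Omega$, hence linear and
    monotone on all functions of the field. *)
Definition confetti_mean N (F : sign_field -> R) : R :=
  \sum_s field_prob P pt (fun i => real_site (@box_site N i)) s * F (box_field s).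

Lemma confetti_field_law :
  field_law (4 * 3 * (32 * c * 3 ^+ 16)) confetti_mean.
Proof.
split.
- move=> N a b F G; rewrite /confetti_mean !big_distrr -big_split /=.
  by apply: eq_bigr => s _; ring.
- move=> N; rewrite /confetti_mean; under eq_bigr do rewrite mulr1.
  exact: (field_prob_sum pt_space ppp).
- move=> N F G FG; apply: ler_sum => s _; apply: ler_wpM2l => //.
  exact: field_prob_ge0.
- move=> N N' x t F loc xN tN.
  have ex i : exists j, @box_site N' j = ((@box_site N i).1 + x, ((@box_site N i).2 + t)%N).
    have [h1 h2] := box_site_in i; apply: box_site_ex; lia.
  have [iota iotaE] := choice ex.
  pose v : R * R := (x%:~R, t%:R).
  transitivity (\sum_s field_prob P pt (fun i => real_site (@box_site N' i)) s *
      F (box_field [ffun i => s (iota i)])).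
    apply: eq_bigr => s _; congr (_ * _); apply: loc => y r yN rN.
    have [i iE] := box_site_ex yN rN.
    have -> : y = (box_site i).1 by rewrite iE.
    have -> : r = (box_site i).2 by rewrite iE.
    rewrite box_fieldE ffunE -[in RHS]box_fieldE iotaE //=.
  rewrite (field_prob_marginal (fun i => real_site (box_site i)) iota
    (fun s => F (box_field s))).
  rewrite /confetti_mean -[RHS](field_prob_translate _ v); apply: eq_bigr => s _.
  congr (field_prob P pt _ s * _); apply/funext => i; rewrite iotaE /real_site /=.
  by rewrite intrD natrD.
- move=> N n g Phi B g1 PB loc.
  pose F1 (i : box_index N) := ((box_site i).2 < n)%N.
  pose F2 (i : box_index N) := (n + g <= (box_site i).2)%N.
  apply: le_trans (field_prob_mix (F1 := F1) (F2 := F2) g1 _ _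
    (fun s t => PB (box_field s) (box_field t))) _.
  + move=> i j; rewrite /F1 /F2 /real_site => h1 h2.
    by rewrite /= lerBrDr -natrD ler_nat; move: h1 h2 => /=; lia.
  + move=> s s' t t' hs ht; apply: loc => y r hr; rewrite /box_field.
      by case: pickP => // i /eqP iE; apply: hs; rewrite -[_ \in _]/(F1 i) /F1 iE.
    by case: pickP => // i /eqP iE; apply: ht; rewrite -[_ \in _]/(F2 i) /F2 iE.
  + have B0 : 0 <= B by apply: le_trans (PB (fun _ _ => None) (fun _ _ => None)).
    have gp : 0 < g%:R ^+ 16 :> R by rewrite exprn_gt0// ltr0n; lia.
    have cN : #|{: 'I_(2 * N).+1 * 'I_N}|%:R <= 3 * N%:R ^+ 2 :> R.
      rewrite card_prod !card_ord -natrX -natrM ler_nat; nia.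
    set Q := 32 * c * 3 ^+ 16.
    have Q0 : 0 <= Q by rewrite /Q !mulr_ge0 ?exprn_ge0// ltW.
    rewrite (_ : B * _ = 4 * B * (3 * N%:R ^+ 2 * (Q / g%:R ^+ 16))); last by ring.
    apply: ler_wpM2l; first by rewrite mulr_ge0.
    by apply: ler_wpM2r => //; rewrite divr_ge0// ltW.
Qed.

End ConfettiField.

(** * Paths of the walk and conclusion *)

Section Paths.
Context (R : realType).
Implicit Types (u : int -> nat -> R) (x : int) (l : seq bool).

Definition jump (a : bool) : int := if a then 1 else -1.
Definition endpoint x l : int := foldl (fun y a => y + jump a) x l.

Fixpoint path_weight u k x l : R :=
  if l is a :: l' then
    (if a then u x k else 1 - u x k) * path_weight u k.+1 (x + jump a) l'
  else 1.

Lemma walk_mean_paths u k m h x :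
  walk_mean u k m h x =
  \sum_(l : m.-tuple bool) path_weight u k x l * h (endpoint x l).
Proof.
elim: m k x => [|m IH] k x /=.
  rewrite (big_pred1 [tuple]) => [|l]; last by apply/esym/eqP; exact: tuple0.
  by rewrite mul1r.
rewrite (reindex (fun p : bool * m.-tuple bool => [tuple of p.1 :: p.2])) /=; last first.
  exists (fun l : m.+1.-tuple bool => (thead l, [tuple of behead l])) => [[t l] _|l _] /=.
    by congr (_, _); apply: val_inj.
  by rewrite -tuple_eta.
rewrite -(pair_bigA _ (fun a (l : m.-tuple bool) =>
  path_weight u k x (a :: l) * h (endpoint x (a :: l)))) /= big_bool /=.
rewrite /step_mean !IH !big_distrr /=; congr (_ + _);
  by apply: eq_bigr => l _; rewrite mulrA.
Qed.

Lemma path_weight_ge0 u k x l : (forall y t, 0 <= u y t <= 1) -> 0 <= path_weight u k x l.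
Proof.
move=> u01; elim: l k x => [|a l IH] k x //=; apply: mulr_ge0 => //.
by have /andP[? ?] := u01 x k; case: a; rewrite ?subr_ge0.
Qed.

Lemma eq_path_weight u u' k x l :
  (forall y t, (k <= t < k + size l)%N -> (`|y - x| < size l)%N -> u y t = u' y t) ->
  path_weight u k x l = path_weight u' k x l.
Proof.
elim: l k x => [|a l IH] k x //= H.
rewrite H ?subrr//; last lia.
by rewrite (IH k.+1)// => y t tl yx; apply: H; move: yx; rewrite /jump; case: a; lia.
Qed.

(** Paths of the walk are encoded by their steps, [true] for a step to the
    right. *)
Lemma path_weight_quenched (delta : R) (f : int * int -> R) n (l : n.-tuple bool) :
  quenched_path_prob delta f n (fun k => endpoint 0 (take k l)) =
  path_weight (up_prob delta f) 0 0 l.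
Proof.
rewrite /quenched_path_prob take0 /= mul1r.
have gen (s : seq bool) k x :
    \prod_(i < size s) step_prob delta f (k + i) (endpoint x (take i s))
      (endpoint x (take i.+1 s)) = path_weight (up_prob delta f) k x s.
  elim: s k x => [|a s IH] k x /=; first by rewrite big_ord0.
  rewrite big_ord_recl /= take0 addn0 /=; congr (_ * _).
    by rewrite /step_prob /jump; case: a; rewrite ?eqxx// (inj_eq (addrI x)).
  rewrite -IH; apply: eq_bigr => i _.
  by rewrite /= /bump leq0n add1n addSnnS.
have := gen l 0%N 0; rewrite size_tuple => <-.
by apply: eq_bigr => i _; rewrite add0n.
Qed.

Lemma endpoint_inj n (l l' : n.-tuple bool) :
  (forall k, (k <= n)%N -> endpoint 0 (take k l) = endpoint 0 (take k l')) -> l = l'.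
Proof.
move=> H; apply: val_inj => /=.
have gen (s s' : seq bool) x : size s = size s' ->
    (forall k, (k <= size s)%N -> endpoint x (take k s) = endpoint x (take k s')) -> s = s'.
  elim: s s' x => [|a s IH] [|a' s'] x //= [ss] h.
  have e := h 1%N isT; rewrite /= !take0 /= in e.
  have ea : a = a' by move: e => /addrI; rewrite /jump; case: a {h}; case: a'.
  by rewrite -ea; congr (_ :: _); apply: (IH _ (x + jump a)) => // k ks;
    have := h k.+1 ks; rewrite /= -ea.
by apply: (gen _ _ 0) => [|k]; rewrite !size_tuple//; exact: H.
Qed.

End Paths.

Section AnnealedPaths.
Context (R : realType) (nu : probability (measurableTypeR R) R).
Context (d : measure_display) (Omega : measurableType d) (P : probability Omega R).
Context (pt : nat -> Omega -> ball_type R).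
Context (pt_space : forall i omega, ball_space (pt i omega)).
Context (ppp : poisson_point_process P (confetti_intensity nu) pt).
Context (delta : R) (delta01 : 0 <= delta <= 2^-1).
Local Notation mean := (confetti_mean P pt).

Lemma integral_sign_mark (I : finType) (z : I -> R * R) (g : mark I -> R) :
  (forall s, 0 <= g s) ->
  (\int[P]_omega (g (sign_mark z (pt ^~ omega)))%:E =
   (\sum_s field_prob P pt z s * g s)%:E)%E.
Proof.
move=> g0; pose A s := [set omega | sign_mark z (pt ^~ omega) = s].
have mA s : measurable (A s) by exact: (measurable_sign_mark pt_space ppp).
rewrite (eq_integral (fun omega => \sum_s ((g s)%:E * (\1_(A s) omega)%:E))%E); last first.
  move=> omega _; rewrite (bigD1 (sign_mark z (pt ^~ omega))) //= big1 ?adde0.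
    by rewrite indicE mem_set// mule1.
  move=> s sn; rewrite indicE memNset ?mule0//.
  by move=> e; move: sn; rewrite -e eqxx.
rewrite ge0_integral_sum//; first last.
- by move=> s omega _; rewrite mule_ge0// lee_fin.
- by move=> s; apply/measurable_EFinP; apply: measurable_funM => //.
rewrite -sumEFin; apply: eq_bigr => s _.
rewrite ge0_integralZl//; first last.
- by rewrite lee_fin.
- by apply/measurable_EFinP; exact: measurable_indic.
rewrite integral_indic// setIT EFinM muleC; congr (_ * _)%E.
by rewrite (field_probK pt_space ppp).
Qed.

Lemma up_prob_sign_mark N omega y t : (`|y| <= N)%N -> (t < N)%N ->
  up_prob delta (confetti_env (pt ^~ omega)) y t =
  up_of delta (box_field (sign_mark (fun i => real_site R (@box_site N i)) (pt ^~ omega))) y t.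
Proof.
move=> yN tN; have [i iE] := box_site_ex yN tN.
have -> : y = (box_site i).1 by rewrite iE.
have -> : t = (box_site i).2 by rewrite iE.
rewrite /up_prob /up_of box_fieldE ffunE; congr (_ + _ * _).
rewrite /confetti_env /real_site /sign_opt /=; set x := confetti _ _.
by case: (ltgtP x 0) => _ /=; rewrite ?subr0 ?sub0r.
Qed.

Lemma annealed_path_weight n (l : n.-tuple bool) :
  (\int[P]_omega (quenched_path_prob delta (confetti_env (pt ^~ omega)) n
      (fun k => endpoint 0 (take k l)))%:E =
   (mean n (fun e => path_weight (up_of delta e) 0 0 l))%:E)%E.
Proof.
rewrite /confetti_mean -integral_sign_mark; last first.
  by move=> s; apply: path_weight_ge0 => y t; exact: up_of01.
apply: eq_integral => omega _; congr EFin; rewrite path_weight_quenched.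
apply: eq_path_weight => y t; rewrite size_tuple => tn yn.
by apply: up_prob_sign_mark; lia.
Qed.

Context (X : nat -> Omega -> int).
Context (rw : random_walk_in P delta (fun omega => confetti_env (pt ^~ omega)) X).

Lemma measurable_walk n (Q : int -> bool) : measurable [set omega | Q (X n omega)].
Proof.
rewrite (_ : [set _ | _] = \bigcup_(x : int) (if Q x then X n @^-1` [set x] else set0)).
  apply: countable_bigcupT_measurable; first exact: countableP.
  by move=> x; case: ifP => // _; exact: (rw_measurable rw).
apply/seteqP; split=> omega /=; first by move=> q; exists (X n omega) => //; rewrite q.
by move=> [x _]; case: ifP => // q /= ->.
Qed.

(** The paths encoded by steps give disjoint events; summing their probabilities
    yields a lower bound, which is the direction that the theorem needs. *)
Lemma walk_law_prob n (Q : int -> bool) :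
  ((walk_law mean delta n (fun x => (Q x)%:R))%:E <= P [set omega | Q (X n omega)])%E.
Proof.
pose A (l : n.-tuple bool) :=
  [set omega | forall k, (k <= n)%N -> X k omega = endpoint 0 (take k l)].
have mA l : measurable (A l).
  rewrite (_ : A l = \bigcap_k (if (k <= n)%N then
      X k @^-1` [set endpoint 0 (take k l)] else setT)).
    by apply: bigcapT_measurable => k; case: ifP => // _; exact: (rw_measurable rw).
  apply/seteqP; split=> omega /= h k; first by case: ifP => // kn _; exact: h.
  by move=> kn; have := h k I; rewrite kn.
have PA l : P (A l) = (mean n (fun e => path_weight (up_of delta e) 0 0 l))%:E.
  rewrite -annealed_path_weight.
  have := rw_law rw n (fun k => endpoint 0 (take k l)) (A := setT).
  rewrite setTI; apply; rewrite /env_sigma_algebra.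
  by rewrite -[X in _ X](setD0 setT); apply: sigma_algebraCD; exact: sigma_algebra0.
apply: (@le_trans _ _ (P (\bigcup_(l in [set l | Q (endpoint 0 (tval l))]) A l))).
  rewrite -sum_measure_fin; first last.
  - by move=> l _; exact: mA.
  - move=> l l' _ _ [omega [h h']]; apply: endpoint_inj => k kn.
    by rewrite -h// -h'.
  rewrite (eq_bigr _ (fun l _ => PA l)) sumEFin lee_fin.
  rewrite /walk_law /confetti_mean exchange_big /=.
  apply: ler_sum => s _; rewrite walk_mean_paths big_distrr /= [leRHS]big_mkcond /=.
  by apply: ler_sum => l _; case: ifP => q; rewrite ?mulr1// !mulr0.
apply: le_measure; rewrite ?inE.
- by apply: fin_bigcup_measurable => //; exact: finite_finset.
- exact: measurable_walk.
move=> omega [l /= q h]; have := h n (leqnn n).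
by rewrite take_oversize ?size_tuple// => ->.
Qed.

End AnnealedPaths.

Theorem corollary1p6 (R : realType) :
  exists alpha0 : R, 2 < alpha0 /\
  forall alpha : R, alpha0 <= alpha ->
  forall nu : probability (measurableTypeR R) R,
    nu `[0, +oo[%classic = 1%E ->
    (exists2 c_nu : R, 0 < c_nu &
       forall r : R, 0 < r -> (nu `[r, +oo[%classic <= (c_nu * r `^ (- alpha))%:E)%E) ->
  exists c2 xi : R, [/\ 0 < c2, 0 < xi &
  forall delta : R, 0 <= delta <= 2^-1 -> delta <= c2 ->
  forall (d : measure_display) (Omega : measurableType d)
    (P : probability Omega R) (b : nat -> Omega -> ball_type R)
    (X : nat -> Omega -> int),
    (forall i omega, ball_space (b i omega)) ->
    poisson_point_process P (confetti_intensity nu) b ->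
    random_walk_in P delta (fun omega => confetti_env (b ^~ omega)) X ->
    (0 < ereal_inf [set P [set omega | (n%:R `^ xi <= `|X n omega|%:~R :> R)%R]
                   | n in [set n : nat | (1 <= n)%N]])%E].
Proof.
exists 20; split; first lra.
move=> alpha alpha20 nu _ [c c0 nu_tail].
have D0 : 0 <= 4 * 3 * (32 * c * 3 ^+ 16) :> R by rewrite !mulr_ge0 ?exprn_ge0// ltW.
have [c2 [xi [c20 xi0 H]]] := walk_spread D0.
exists c2, xi; split=> // delta d01 dc2 d Omega P b X bS ppp rw.
have law := confetti_field_law c0 alpha20 nu_tail bS ppp.
have [p p0 Hp] := H _ law delta d01 dc2.
apply: (@lt_le_trans _ _ p%:E); first by rewrite lte_fin.
apply: le_ereal_inf_tmp => _ [n n1 <-].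
apply: le_trans (walk_law_prob bS ppp d01 rw n (fun x => n%:R `^ xi <= `|x|%:~R)).
by rewrite lee_fin; exact: Hp.
Qed.
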